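(* Let $d\geqslant 1$, let $\sigma\in\mathbb R^{d\times d}$ and let $b\in\mathcal C^2(\mathbb R^d,\mathbb R^d)$ have bounded second-order derivatives and be such that there exists $L>0$ with $(x-y)\cdot(b(x)-b(y))\leqslant L|x-y|^2$ for all $x,y\in\mathbb R^d$. Then, for all $p\geqslant 1$, \[\beta_p(t)=1-\lambda^*t+o(t)\qquad\text{as }t\to 0.\]
   Context: $|\cdot|$ is the Euclidean norm, $\mathbb S^{d-1}$ the unit sphere of $\mathbb R^d$, and $\nabla b$ the Jacobian matrix of $b$. Consider the SDE $dX_t=b(X_t)\,dt+\sigma\,dB_t$ on $\mathbb R^d$, where $\sigma$ is a constant, possibly singular, matrix and $B$ is a standard Brownian motion in $\mathbb R^d$; $\nu P_t$ is the law of $X_t$ when $X_0\sim\nu$. The Bakry-Emery curvature is \[\lambda^*=-\sup\{v\cdot\nabla b(x)v:\ x\in\mathbb R^d,\ v\in\mathbb S^{d-1}\}.\] $\mathcal P_p(\mathbb R^d)$ is the set of probability measures on $\mathbb R^d$ with finite $p$-th moment, $\mathcal W_p$ is the $L^p$ Wasserstein distance associated with the Euclidean distance, and \[\beta_p(t)=\sup_{\nu,\mu\in\mathcal P_p(\mathbb R^d),\ \nu\neq\mu}\frac{\mathcal W_p(\nu P_t,\mu P_t)}{\mathcal W_p(\nu,\mu)}=\sup_{x\neq y}\frac{\mathcal W_p(\delta_xP_t,\delta_yP_t)}{|x-y|}.\] *)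

(* Defs.v *)
From HB Require Import structures.
From mathcomp Require Import all_boot all_order all_algebra.
From mathcomp Require Import all_classical all_reals all_analysis.

Set Implicit Arguments.
Unset Strict Implicit.
Unset Printing Implicit Defensive.

Import Order.TTheory GRing.Theory Num.Theory.
Import numFieldNormedType.Exports.

Local Open Scope classical_set_scope.
Local Open Scope ring_scope.

(* Points of R^d are row vectors 'rV[R]_d.  The norm `|x| that the library puts
   on matrices is the sup norm: it only serves for the topology (and hence for
   continuity, derivatives and Borel sets); metric quantities use [enorm]. *)

Section borel_matrix.
Context (R : realType) (m n : nat).

Let borel : set (set 'M[R]_(m, n)) := <<s @open 'M[R]_(m, n) >>.

Let borel0 : borel set0. Proof. exact: sigma_algebra0. Qed.

Let borelC A : borel A -> borel (~` A). Proof. exact: sigma_algebraC. Qed.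

Let borel_bigcup (F : (set 'M[R]_(m, n))^nat) :
  (forall i, borel (F i)) -> borel (\bigcup_i F i).
Proof. exact: sigma_algebra_bigcup. Qed.

HB.instance Definition _ :=
  @isMeasurable.Build (sigma_display (@open 'M[R]_(m, n)))
    'M[R]_(m, n) borel borel0 borelC borel_bigcup.

End borel_matrix.

Section euclidean.
Context (R : realType) (d : nat).
Implicit Types (u v x y : 'rV[R]_d) (b : 'rV[R]_d -> 'rV[R]_d).

Definition dot u v : R := \sum_(i < d) u 0 i * v 0 i.

Definition enorm x : R := Num.sqrt (dot x x).

Definition partial (i : 'I_d) b : 'rV[R]_d -> 'rV[R]_d :=
  fun x => 'D_(delta_mx 0 i) b x.

Fixpoint class_C (k : nat) b : Prop :=
  continuous b /\
  match k with
  | 0 => True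
  | k'.+1 => forall i : 'I_d,
      (forall x, derivable b x (delta_mx 0 i)) /\ class_C k' (partial i b)
  end.

Definition bounded_second_derivatives b : Prop :=
  exists M : R, forall (i j : 'I_d) x, enorm (partial i (partial j b) x) <= M.

Definition one_sided_lipschitz b : Prop :=
  exists L : R, 0 < L /\
    forall x y, dot (x - y) (b x - b y) <= L * enorm (x - y) ^+ 2.

(* The library's ['J b x] acts on row vectors: [v *m 'J b x] is the derivative
   of b at x in the direction v, i.e. (nabla b(x)) v.  The supremum is one of
   real numbers; it is meaningful because, for 0 < d and b one-sided Lipschitz
   and differentiable, the set is nonempty and bounded above. *)
Definition bakry_emery_curvature b : R :=
  - sup [set q : R | exists x v, enorm v = 1 /\ q = dot v (v *m 'J b x)].

End euclidean.

Section brownian_sde.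
Context (R : realType).

Definition mutually_independent d0 (Omega : measurableType d0)
    (P : probability Omega R) (I : finType) d1 (T : measurableType d1)
    (X : I -> Omega -> T) : Prop :=
  forall A : I -> set T, (forall i, measurable (A i)) ->
    P (\bigcap_i (X i @^-1` A i)) = (\prod_(i : I) P (X i @^-1` A i))%E.

Context (d : nat).
Notation V := 'rV[R]_d.

(* Processes are indexed by R but only their restriction to [0, +oo[ matters. *)
Record standard_brownian_motion d0 (Omega : measurableType d0)
    (P : probability Omega R) (B : R -> Omega -> V) : Prop := {
  bm_measurable : forall t, 0 <= t -> measurable_fun setT (B t) ;
  bm_start : {ae P, forall w, B 0 w = 0} ;
  bm_continuous : {ae P, forall w, {within `[0, +oo[, continuous (B ^~ w)}} ;
  bm_independent_increments : forall (n : nat) (s : nat -> R),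
    0 <= s 0 -> (forall k, s k <= s k.+1) ->
    mutually_independent P
      (fun (k : 'I_n) w => B (s k.+1) w - B (s k) w) ;
  bm_gaussian_increments : forall s t, 0 <= s -> s < t ->
    mutually_independent P (fun (i : 'I_d) w => (B t w - B s w) 0 i) /\
    forall (i : 'I_d) (A : set R), measurable A ->
      P ((fun w => (B t w - B s w) 0 i) @^-1` A)
      = normal_prob 0 (Num.sqrt (t - s)) A }.

(* Independence from sigma(B_t, t >= 0), tested on the pi-system of
   finite-dimensional cylinders. *)
Definition independent_of_process d0 (Omega : measurableType d0)
    (P : probability Omega R) (X0 : Omega -> V) (B : R -> Omega -> V) : Prop :=
  forall (n : nat) (s : 'I_n -> R) (A0 : set V) (A : 'I_n -> set V),
    (forall k, 0 <= s k) -> measurable A0 -> (forall k, measurable (A k)) ->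
    P (X0 @^-1` A0 `&` \bigcap_k (B (s k) @^-1` A k))
    = (P (X0 @^-1` A0) * P (\bigcap_k (B (s k) @^-1` A k)))%E.

Variables (b : V -> V) (sigma : 'M[R]_d).

Definition drift_integral (x : R -> V) (t : R) : V :=
  \row_(i < d) \int[@lebesgue_measure R]_(s in `[0, t]) b (x s) 0 i.

(* As the noise is additive, dX = b(X) dt + sigma dB is the pathwise integral
   equation below; sigma B_t reads [B t w *m sigma^T] on row vectors. *)
Record sde_solution (nu : probability V R) d0 (Omega : measurableType d0)
    (P : probability Omega R) (B X : R -> Omega -> V) : Prop := {
  sol_brownian : standard_brownian_motion P B ;
  sol_measurable : forall t, 0 <= t -> measurable_fun setT (X t) ;
  sol_initial_law : forall A, measurable A -> P (X 0 @^-1` A) = nu A ;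
  sol_initial_independent : independent_of_process P (X 0) B ;
  sol_continuous : {ae P, forall w, {within `[0, +oo[, continuous (X ^~ w)}} ;
  sol_equation : {ae P, forall w, forall t, 0 <= t ->
    X t w = X 0 w + drift_integral (X ^~ w) t + B t w *m sigma^T} }.

(* [Pt t nu] is nu P_t, the law at time t of a solution with X_0 ~ nu. *)
Definition is_sde_semigroup
    (Pt : R -> probability V R -> probability V R) : Prop :=
  forall nu : probability V R,
    exists (d0 : measure_display) (Omega : measurableType d0)
           (P : probability Omega R) (B X : R -> Omega -> V),
      sde_solution nu P B X /\
      forall t A, 0 <= t -> measurable A -> Pt t nu A = P (X t @^-1` A).

End brownian_sde.

Section wasserstein.
Context (R : realType) (d : nat).
Notation V := 'rV[R]_d.
Implicit Types (mu nu : probability V R) (p : R).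

Definition finite_moment p nu : Prop :=
  (\int[nu]_x ((enorm x) `^ p)%:E < +oo)%E.

Definition coupling mu nu (pi : probability (V * V)%type R) : Prop :=
  forall A, measurable A ->
    pi (fst @^-1` A) = mu A /\ pi (snd @^-1` A) = nu A.

Definition wasserstein p mu nu : \bar R :=
  poweR (ereal_inf
    [set c | exists pi : probability (V * V)%type R, coupling mu nu pi /\
               c = (\int[pi]_z ((enorm (z.1 - z.2)) `^ p)%:E)%E]) p^-1.

(* Two measures are distinct when they differ on some measurable set; Leibniz
   equality would also look at their junk values on non-measurable sets. *)
Definition contraction_rate (Pt : R -> probability V R -> probability V R)
    p (t : R) : \bar R :=
  ereal_sup
    [set r | exists nu mu : probability V R,
       [/\ finite_moment p nu, finite_moment p mu,
           (exists2 A, measurable A & nu A <> mu A) &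
           r = (wasserstein p (Pt t nu) (Pt t mu) / wasserstein p nu mu)%E]].

End wasserstein.

(* Main.v *)
Require Import Defs.
From HB Require Import structures.
From mathcomp Require Import all_boot all_order all_algebra.
From mathcomp Require Import all_classical all_reals all_analysis.
From mathcomp Require Import measurable_realfun ring lra.
Set Implicit Arguments.
Unset Strict Implicit.
Unset Printing Implicit Defensive.
Import Order.TTheory GRing.Theory Num.Theory.
Import numFieldNormedType.Exports.
Local Open Scope classical_set_scope.
Local Open Scope ring_scope.

(** Write [lam] for the curvature. The claim follows from [exp (- lam t)] as an
upper bound and from [1 - lam t - e t], for every [e > 0] and small [t], as a
lower bound for the contraction rate at time [t].

Upper bound. Let two solutions be driven by the same Brownian motion: the noise
cancels in their difference, and the drift is one-sided Lipschitz with constant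
[- lam] ([drift_one_sided]), so [|X_t - Y_t| <= exp (- lam t) |X_0 - Y_0|].
Starting from any coupling of the initial laws this yields a coupling at time
[t] ([synchronous_coupling]), hence the bound on the distances.

The semigroup is only given through the laws of its solutions, each on its own
probability space, so a joint realisation has to be built. A solution at time
[t] is the limit of Euler schemes, which are explicit continuous functions of
the initial point and of the values of the noise at dyadic times
([path_scheme_converges]). The joint law of these data is the product of the
initial law and of a Wiener law that does not depend on the space
([dyadic_path_law], [initial_path_law]). Almost sure convergence of the schemes
is a property of that joint law; it therefore holds on the product space, where
it defines a measurable flow ([flow], [solution_law]), without solving any
differential equation there. The contraction of the flow is inherited from that
of the schemes ([scheme_contraction]).

Lower bound. Choose [x] and a unit vector [v] with [v . grad b(x) v >= - lam -
e], and compare the point masses at [x] and [y = x + del v] for a small fixed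
[del]. While the Brownian path stays small, both schemes stay near [x] and
[v . (Y_t - X_t) >= del (1 + t (v . grad b(x) v - e))] ([euler_expansion]). By
chaining over dyadic increments this fails with probability [O(t^2)] only
([quiet_probability]), and then the contraction above limits the loss to
[O(del)]. Integrating the truncated functional [z |-> 1 + v . (z - x)], which is
1-Lipschitz, bounds the Wasserstein distance from below
([mean_separation], [kantorovich_lower]).

Both bounds rest on an expansion of the drift with global constants,
[|b(x + u) - b(x) - grad b(x) u| <= C |u|^2] and [grad b] Lipschitz, which the
bounded second derivatives provide ([c2_taylor]). *)

(** * Euclidean norm *)

Section euclidean_norm.
Context (R : realType) (d : nat).
Implicit Types (u v x y z : 'rV[R]_d).

Lemma dotC u v : dot u v = dot v u.
Proof. by apply: eq_bigr => i _; rewrite mulrC. Qed.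

Lemma dotDl u v x : dot (u + v) x = dot u x + dot v x.
Proof. by rewrite /dot -big_split; apply: eq_bigr => i _; rewrite mxE mulrDl. Qed.

Lemma dotZl a u v : dot (a *: u) v = a * dot u v.
Proof. by rewrite /dot mulr_sumr; apply: eq_bigr => i _; rewrite mxE mulrA. Qed.

Lemma dotNl u v : dot (- u) v = - dot u v.
Proof. by rewrite -scaleN1r dotZl mulN1r. Qed.

Lemma dotDr x u v : dot x (u + v) = dot x u + dot x v.
Proof. by rewrite dotC dotDl !(dotC x). Qed.

Lemma dotZr a u v : dot u (a *: v) = a * dot u v.
Proof. by rewrite dotC dotZl dotC. Qed.

Lemma dotNr u v : dot u (- v) = - dot u v.
Proof. by rewrite dotC dotNl dotC. Qed.

Lemma dot0l u : dot 0 u = 0.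
Proof. by rewrite -(scale0r 0) dotZl mul0r. Qed.

Lemma dot_sumr u n (f : 'I_n -> 'rV[R]_d) :
  dot u (\sum_(i < n) f i) = \sum_(i < n) dot u (f i).
Proof.
elim/big_ind2: _ => [|a b a' b' <- <-|//]; first by rewrite dotC dot0l.
by rewrite dotDr.
Qed.

Lemma dot_ge0 u : 0 <= dot u u.
Proof. by apply: sumr_ge0 => i _; rewrite -expr2 sqr_ge0. Qed.

Lemma enorm_ge0 u : 0 <= enorm u.
Proof. exact: sqrtr_ge0. Qed.

Lemma sqr_enorm u : enorm u ^+ 2 = dot u u.
Proof. by rewrite sqr_sqrtr ?dot_ge0. Qed.

Lemma coord_enorm u i : `|u 0 i| <= enorm u.
Proof.
rewrite -(ler_pXn2r (n := 2)) ?nnegrE ?enorm_ge0//.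
rewrite sqr_enorm real_normK ?num_real//.
rewrite /dot (bigD1 i)//= -expr2 lerDl.
by apply: sumr_ge0 => j _; rewrite -expr2 sqr_ge0.
Qed.

Lemma enorm_eq0 u : enorm u = 0 -> u = 0.
Proof.
move=> u0; apply/rowP => i; apply/eqP; rewrite mxE -normr_le0 -u0.
exact: coord_enorm.
Qed.

Lemma dot_le_enorm u v : dot u v <= enorm u * enorm v.
Proof.
have [/enorm_eq0 ->|v0] := eqVneq (enorm v) 0.
  by rewrite dotC dot0l mulr_ge0 ?enorm_ge0.
have vv : 0 < dot v v by rewrite -sqr_enorm exprn_gt0// lt_neqAle eq_sym v0 enorm_ge0.
have := dot_ge0 (dot v v *: u - dot u v *: v).
rewrite !(dotDl, dotDr, dotNl, dotNr, dotZl, dotZr) (dotC v u).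
set a := dot u u; set b := dot u v; set c := dot v v => h.
have h1 : 0 <= a * c - b ^+ 2.
  rewrite -(pmulr_rge0 _ vv); apply: le_trans h _.
  by rewrite le_eqVlt; apply/orP; left; apply/eqP; rewrite /c; ring.
apply: le_trans (ler_norm _) _.
rewrite -(ler_pXn2r (n := 2)) ?nnegrE ?mulr_ge0 ?enorm_ge0//.
by rewrite real_normK ?num_real// exprMn !sqr_enorm -subr_ge0.
Qed.

Lemma normr_dot u v : `|dot u v| <= enorm u * enorm v.
Proof.
rewrite ler_norml dot_le_enorm andbT lerNl -dotNl (le_trans (dot_le_enorm _ _))//.
by rewrite /enorm dotNl dotNr opprK.
Qed.

Lemma enormZ a u : enorm (a *: u) = `|a| * enorm u.
Proof. by rewrite /enorm dotZl dotZr mulrA -expr2 sqrtrM ?sqr_ge0// sqrtr_sqr. Qed.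

Lemma enorm0 : enorm (0 : 'rV[R]_d) = 0.
Proof. by rewrite /enorm dot0l sqrtr0. Qed.

Lemma enormN u : enorm (- u) = enorm u.
Proof. by rewrite -scaleN1r enormZ normrN1 mul1r. Qed.

Lemma enorm_distC u v : enorm (u - v) = enorm (v - u).
Proof. by rewrite -enormN opprB. Qed.

Lemma ler_enormD u v : enorm (u + v) <= enorm u + enorm v.
Proof.
rewrite -(ler_pXn2r (n := 2)) ?nnegrE ?addr_ge0 ?enorm_ge0//.
rewrite sqr_enorm sqrrD !dotDl !dotDr (dotC v u) -!sqr_enorm.
have := dot_le_enorm u v; lra.
Qed.

Lemma ler_enormB u v : enorm (u - v) <= enorm u + enorm v.
Proof. by rewrite -(enormN v) ler_enormD. Qed.

Lemma ler_enorm_sum n (f : 'I_n -> 'rV[R]_d) :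
  enorm (\sum_(i < n) f i) <= \sum_(i < n) enorm (f i).
Proof.
elim/big_rec2: _ => [|i y x _ ih]; first by rewrite enorm0.
by rewrite (le_trans (ler_enormD _ _))// lerD2l.
Qed.

Lemma enorm_delta i : enorm (delta_mx 0 i : 'rV[R]_d) = 1.
Proof.
rewrite /enorm /dot (bigD1 i)//= big1 ?addr0 ?mxE ?eqxx ?mulr1 ?sqrtr1//.
by move=> j ji; rewrite mxE eqxx (negPf ji) mulr0.
Qed.

Lemma enorm_le_coord u v : (forall i, `|u 0 i| <= `|v 0 i|) -> enorm u <= enorm v.
Proof.
move=> uv; rewrite ler_wsqrtr// ler_sum// => i _.
rewrite -!expr2 -(real_normK (num_real (u 0 i))) -(real_normK (num_real (v 0 i))).
by rewrite ler_pXn2r ?nnegrE.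
Qed.

Lemma enorm_le_sum u : enorm u <= \sum_(i < d) `|u 0 i|.
Proof.
rewrite [in leLHS](row_sum_delta u) (le_trans (ler_enorm_sum _))//.
by apply: ler_sum => i _; rewrite enormZ enorm_delta mulr1.
Qed.

Lemma enorm_le_bound u c : (forall i, `|u 0 i| <= c) -> enorm u <= d%:R * c.
Proof.
move=> uc; apply: le_trans (enorm_le_sum u) _.
rewrite mulr_natl -[X in _ *+ X](card_ord d) -sumr_const.
exact: ler_sum.
Qed.

(** Together with its converse below: the Euclidean norm is equivalent to the
sup norm, through which the topology and the derivatives are defined. *)
Lemma enorm_le_mx_norm u : enorm u <= d%:R * `|u|.
Proof.
apply: enorm_le_bound => i; rewrite [in leRHS]/Num.norm/= mx_normrE.
by rewrite (le_bigmax _ (fun ij : 'I_1 * 'I_d => `|u ij.1 ij.2|) (0, i)).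
Qed.

Lemma mx_norm_le_enorm u : `|u| <= enorm u.
Proof.
rewrite [in leLHS]/Num.norm/= mx_normrE; apply: bigmax_le; first exact: enorm_ge0.
by move=> [i j] _ /=; rewrite (ord1 i) coord_enorm.
Qed.

Lemma enorm_mulmx u (M : 'M[R]_d) :
  enorm (u *m M) <= (\sum_i enorm (row i M)) * enorm u.
Proof.
rewrite mulmx_sum_row (le_trans (ler_enorm_sum _))// mulr_suml.
apply: ler_sum => i _; rewrite enormZ mulrC ler_wpM2l ?enorm_ge0//.
exact: coord_enorm.
Qed.

End euclidean_norm.

(** * Second-order expansion of the drift *)

Section taylor.
Context (R : realType) (d : nat).
Notation V := 'rV[R]_d.

Lemma derive_line (f : V -> R) (e z : V) (s : R) :
  derivable f (s *: e + z) e ->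
  is_derive s (1 : R) (fun r : R => f (r *: e + z)) ('D_e f (s *: e + z)).
Proof.
move=> df.
have E : (fun h : R => h^-1 *: (((fun r : R => f (r *: e + z)) \o shift s) (h *: 1) -
            f (s *: e + z))) =
    (fun h : R => h^-1 *: ((f \o shift (s *: e + z)) (h *: e) - f (s *: e + z))).
  apply/funext => h /=.
  by rewrite scalerDl addrA [h *: 1]mulr1.
by split; [rewrite /derivable E|rewrite /derive E].
Qed.

Lemma coordinate_mvt (f : V -> R) (e z : V) (a : R) :
  (forall x, derivable f x e) ->
  exists2 s : R, `|s| <= `|a| & f (a *: e + z) - f z = 'D_e f (s *: e + z) * a.
Proof.
move=> df; pose g (r : R) := f (r *: e + z).
have dg (s : R) : is_derive s (1 : R) g ('D_e f (s *: e + z)) by exact: derive_line.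
have cg (A : set R) : {within A, continuous g}.
  apply: continuous_subspaceT => s.
  apply: differentiable_continuous; apply/derivable1_diffP.
  by have [] := dg s.
have g0 : f z = g 0 by rewrite /g scale0r add0r.
rewrite -[f (a *: e + z)]/(g a) g0.
have [a0|a0] := leP 0 a.
  have [|c] := @MVT_segment R g _ 0 a a0 (fun s _ => dg s); first exact: cg.
  rewrite in_itv/= subr0 => /andP[c0 ca] ->; exists c => //.
  by rewrite !ger0_norm.
have [|c] := @MVT_segment R g _ a 0 (ltW a0) (fun s _ => dg s); first exact: cg.
rewrite in_itv/= sub0r mulrN => /andP[ca c0] h; exists c.
  by rewrite (ler0_norm c0) (ltr0_norm a0) lerN2.
by rewrite -[RHS]opprK -h opprB.
Qed.

(** The increment is split into moves along the coordinate axes, to each of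
which the one-variable mean value theorem applies. *)
Lemma axis_mvt (f : V -> R) (x u : V) :
  (forall i y, derivable f y (delta_mx 0 i)) ->
  exists2 xi : 'I_d -> V, (forall i, enorm (xi i - x) <= enorm u) &
    f (x + u) - f x = \sum_i 'D_(delta_mx 0 i) f (xi i) * u 0 i.
Proof.
move=> df.
pose hyb (k : nat) : V := \row_j (if (j < k)%N then u 0 j else 0).
have hybS (k : 'I_d) : x + hyb k.+1 = u 0 k *: delta_mx 0 k + (x + hyb k).
  rewrite addrCA; congr (_ + _); apply/rowP => j; rewrite !mxE eqxx/= ltnS leq_eqVlt.
  rewrite (inj_eq val_inj); case: eqVneq => [->|jk]/=; last by rewrite mulr0 add0r.
  by rewrite ltnn mulr1 addr0.
have step (k : 'I_d) : exists xi, enorm (xi - x) <= enorm u /\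
    f (x + hyb k.+1) - f (x + hyb k) = 'D_(delta_mx 0 k) f xi * u 0 k.
  have [s su] := coordinate_mvt (x + hyb k) (u 0 k) (df k).
  rewrite -hybS => e; eexists; split; last exact: e.
  rewrite [x + _]addrC addrA addrK; apply: enorm_le_coord => j.
  rewrite !mxE eqxx/=; case: eqVneq => [->|jk]/=.
    by rewrite ltnn mulr1 addr0.
  by rewrite mulr0 add0r; case: ifP => // _; rewrite normr0.
have [xi xiP] := choice step.
exists xi; first by move=> i; have [] := xiP i.
have -> : x + u = x + hyb d by congr (_ + _); apply/rowP => j; rewrite mxE ltn_ord.
have {2}-> : x = x + hyb 0%N.
  by rewrite -[LHS]addr0; congr (_ + _); apply/rowP => j; rewrite !mxE ltn0.
rewrite -(telescope_sumr (fun k => f (x + hyb k)) (leq0n d)) big_mkord.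
by apply: eq_bigr => i _; have [_ ->] := xiP i.
Qed.

(** The candidate Jacobian, assembled from the partial derivatives before
differentiability is known. *)
Definition gradient_mx (b : V -> V) (x : V) : 'M[R]_d :=
  \matrix_(i, j) (partial i b x) 0 j.

Lemma derive_coord (b : V -> V) x e c : derivable b x e ->
  derivable (fun y => b y 0 c) x e /\ 'D_e (fun y => b y 0 c) x = ('D_e b x) 0 c.
Proof.
move=> db; split; first by have /derivable_mxP := db; exact.
by rewrite (derive_mx db) mxE.
Qed.

Lemma partial_lipschitz (g : V -> V) (M : R) :
  (forall i x, derivable g x (delta_mx 0 i)) ->
  (forall i x, enorm (partial i g x) <= M) ->
  forall x y c, `|g x 0 c - g y 0 c| <= d%:R * M * enorm (x - y).
Proof.
move=> dg Mg x y c.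
have [|xi _] := @axis_mvt (fun z => g z 0 c) y (x - y).
  by move=> i z; have [] := derive_coord c (dg i z).
have -> : y + (x - y) = x by rewrite addrC subrK.
move=> ->; apply: le_trans (ler_norm_sum _ _ _) _.
have -> : d%:R * M * enorm (x - y) = \sum_(i < d) M * enorm (x - y).
  by rewrite sumr_const card_ord -mulrA mulr_natl.
apply: ler_sum => i _; rewrite normrM ler_pM ?coord_enorm//.
by have [_ ->] := derive_coord c (dg i (xi i)); exact: le_trans (coord_enorm _ _) (Mg _ _).
Qed.

(** Each partial derivative is Lipschitz because its own partial derivatives
are bounded; the intermediate points of [axis_mvt] lie within [enorm u] of [x],
so replacing them by [x] costs a quadratic error. The constant is global. *)
Lemma c2_taylor_gradient (b : V -> V) : class_C 2 b -> bounded_second_derivatives b ->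
  exists2 C : R, 0 <= C &
    (forall x u : V, enorm (b (x + u) - b x - u *m gradient_mx b x) <= C * enorm u ^+ 2) /\
    (forall x y u : V, enorm (u *m gradient_mx b x - u *m gradient_mx b y)
                     <= C * enorm u * enorm (x - y)).
Proof.
move=> /= [_ C2] [M0 hM0].
pose M := Num.max 0 M0; have M_ge0 : 0 <= M by rewrite le_max lexx.
have hM i j x : enorm (partial i (partial j b) x) <= M.
  by rewrite (le_trans (hM0 i j x))// le_max lexx orbT.
have d1 i x : derivable b x (delta_mx 0 i) by have [] := C2 i.
have d2 i j x : derivable (partial j b) x (delta_mx 0 i).
  by have [_ [_ /(_ i)[]]] := C2 j.
have lip j x y c : `|partial j b x 0 c - partial j b y 0 c| <= d%:R * M * enorm (x - y).
  by apply: partial_lipschitz => [i z|i z]; [exact: d2|exact: hM].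
pose C := d%:R * (d%:R * (d%:R * M)).
exists C; first by rewrite !mulr_ge0.
split=> [x u|x y u].
  rewrite /C -!mulrA; apply: enorm_le_bound => c; rewrite !mxE.
  have [|xi xix ->] := @axis_mvt (fun z => b z 0 c) x u.
    by move=> i z; have [] := derive_coord c (d1 i z).
  rewrite -sumrB (le_trans (ler_norm_sum _ _ _))//.
  rewrite mulr_natl -[X in _ *+ X](card_ord d) -sumr_const ler_sum// => i _.
  rewrite mxE mulrC -mulrBr normrM.
  have [_ ->] := derive_coord c (d1 i (xi i)).
  rewrite expr2 !mulrA mulrC ler_pM ?coord_enorm//.
  rewrite (le_trans (lip _ _ _ _))// ler_wpM2l ?mulr_ge0//.
rewrite /C -!mulrA; apply: enorm_le_bound => c; rewrite -mulmxBr !mxE.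
rewrite (le_trans (ler_norm_sum _ _ _))//.
rewrite mulr_natl -[X in _ *+ X](card_ord d) -sumr_const ler_sum// => i _.
rewrite !mxE normrM [enorm u * _]mulrC !mulrA mulrC ler_pM ?coord_enorm//.
Qed.

Lemma continuous_mulmxr (M : 'M[R]_d) : continuous (fun u : V => u *m M).
Proof.
move=> u; apply/(@cvgrPdist_le _ _ _ (nbhs u)) => e e0.
set K := \sum_i enorm (row i M) * d%:R + 1.
have K0 : 0 < K by rewrite ltr_wpDl// sumr_ge0// => i _; rewrite mulr_ge0 ?enorm_ge0.
apply/nbhs_ballP; exists (e / K); first by rewrite /= divr_gt0.
move=> y; rewrite -ball_normE/= => uy.
rewrite -mulmxBl (le_trans (mx_norm_le_enorm _))// (le_trans (enorm_mulmx _ _))//.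
apply: (@le_trans _ _ (K * `|u - y|)); last first.
  by rewrite -ler_pdivlMl// mulrC ltW.
rewrite mulrDl mul1r -mulr_suml -mulrA ler_wpDr//.
by rewrite ler_wpM2l ?enorm_le_mx_norm// sumr_ge0// => i _; rewrite enorm_ge0.
Qed.

(** A quadratic remainder is in particular [o(u)], so the linear part is the
differential. *)
Lemma jacobian_of_taylor (b : V -> V) (x : V) (A : 'M[R]_d) (C : R) : 0 <= C ->
  (forall u, enorm (b (x + u) - b x - u *m A) <= C * enorm u ^+ 2) ->
  forall u : V, u *m 'J b x = u *m A.
Proof.
move=> C0 T.
pose L : {linear V -> V} := @mulmxr R 1 d d A.
suff E : 'd b x = L :> (V -> V).
  by move=> u; rewrite /jacobian mul_rV_lin1 E.
apply: diff_unique; first exact: continuous_mulmxr.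
apply/eqaddoP => e e0.
pose K : R := C * d%:R ^+ 2 + 1.
have K0 : 0 < K by rewrite ltr_wpDl// mulr_ge0// exprn_ge0.
apply/nbhs_ballP; exists (e / K); first by rewrite /= divr_gt0.
move=> u; rewrite -ball_normE/= sub0r normrN => ue.
have -> : (b \o shift x - (cst (b x) + L)) u = b (x + u) - b x - u *m A.
  by rewrite !fctE/= opprD addrA (addrC u).
rewrite (le_trans (mx_norm_le_enorm _))// (le_trans (T u))//.
apply: (@le_trans _ _ (K * `|u| * `|u|)); last first.
  by rewrite ler_wpM2r// -ler_pdivlMl// mulrC ltW.
rewrite -mulrA -expr2 mulrDl -mulrA -exprMn ler_wpDr ?mul1r ?sqr_ge0//.
by rewrite ler_wpM2l// ler_pXn2r ?nnegrE ?enorm_ge0 ?mulr_ge0// enorm_le_mx_norm.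
Qed.

Lemma c2_taylor (b : V -> V) : class_C 2 b -> bounded_second_derivatives b ->
  exists2 C : R, 0 <= C &
    (forall x u : V, enorm (b (x + u) - b x - u *m 'J b x) <= C * enorm u ^+ 2) /\
    (forall x y u : V, enorm (u *m 'J b x - u *m 'J b y)
                     <= C * enorm u * enorm (x - y)).
Proof.
move=> b2 bM; have [C C0 [T1 T2]] := c2_taylor_gradient b2 bM.
have JE x (u : V) : u *m 'J b x = u *m gradient_mx b x.
  by apply: jacobian_of_taylor C0 _ u => u; exact: T1.
exists C; first exact: C0.
split=> [x u|x y u].
  by rewrite (JE x u); exact: T1.
rewrite (congr2 (fun v w : V => v - w) (JE x u) (JE y u)).
exact: T2.
Qed.

End taylor.

(** * Regularity along a continuous path *)

Section path_regularity.
Context (R : realType) (d : nat).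
Notation V := 'rV[R]_d.
Notation mu := (@lebesgue_measure R).

Lemma within_continuous_enorm (X : R -> V) (T : set R) : {within T, continuous X} ->
  forall s : R, T s -> forall e : R, 0 < e ->
  exists2 r : R, 0 < r & forall s' : R, T s' -> `|s - s'| < r -> enorm (X s - X s') <= e.
Proof.
move=> /subspace_continuousP cX s Ts e e0.
have d0 : 0 < d.+1%:R :> R by rewrite ltr0n.
have e'0 : 0 < e / d.+1%:R by rewrite divr_gt0.
have /(@cvgrPdist_le _ _ _ _ (within_filter _ _)) /(_ _ e'0) := cX s Ts.
rewrite near_withinE => /nbhs_ballP[r /= r0 h]; exists r => // s' Ts' ss'.
have {}h : `|X s - X s'| <= e / d.+1%:R by apply: h => //; rewrite /ball/=.
rewrite (le_trans (enorm_le_mx_norm _))// (le_trans (ler_wpM2l _ h))//.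
by rewrite mulrCA -[leRHS]mulr1 ler_pM2l// ler_pdivrMr// mul1r ler_nat.
Qed.

Lemma within_uniformly_continuous (X : R -> V) (t : R) :
  {within `[0, t], continuous X} -> forall e : R, 0 < e ->
  exists2 r : R, 0 < r & forall s s' : R, s \in `[0, t] -> s' \in `[0, t] ->
    `|s - s'| < r -> enorm (X s - X s') <= e.
Proof.
move=> cX e e0.
have cK : compact `[0, t] by exact: segment_compact.
have e20 : 0 < e / 2 by rewrite divr_gt0.
pose P (r : R) (s : R) := forall s' : R, s' \in `[0, t] -> `|s - s'| < r ->
  s \in `[0, t] -> enorm (X s - X s') <= e.
have := (compact_near_coveringP _).1 cK _ (0^'+) P _.
have H : forall s : R, `[0, t]%classic s -> \forall s' \near s & r \near 0^'+, P r s'.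
  move=> s st; have [r r0 hr] := within_continuous_enorm cX st e20.
  exists (ball (s : R) (r / 2), [set x : R | ball (0 : R) (r / 2) x /\ 0 < x]); first split => /=.
  - by apply: nbhsx_ballx; rewrite divr_gt0.
  - by apply/nbhs_ballP; exists (r / 2); rewrite /= ?divr_gt0// => y.
  move=> [s' r'] /= [ss' [r'r r'0]] s'' s''t s's'' s't.
  rewrite /ball/= in ss'; rewrite /ball/= sub0r normrN gtr0_norm// in r'r.
  have -> : X s' - X s'' = (X s - X s'') - (X s - X s').
    by rewrite [RHS]addrC opprB addrA subrK.
  rewrite (le_trans (ler_enormB _ _))// [leRHS]splitr lerD//; apply: hr => //.
    have -> : s - s'' = (s - s') + (s' - s'') by rewrite addrA subrK.
    by rewrite (le_lt_trans (ler_normD _ _))// [ltRHS]splitr ltrD// (lt_trans s's'').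
  by rewrite (lt_le_trans ss')// ler_pdivrMr// ler_peMr ?ler1n// ltW.
move=> /(_ _ H) /nbhs_ballP[r /= r0 h].
exists (r / 2); first by rewrite divr_gt0.
move=> s s' st s't ss'; apply: (h (r / 2)) => //=; last by rewrite divr_gt0.
by rewrite /ball/= sub0r normrN gtr0_norm ?divr_gt0// ltr_pdivrMr// ltr_pMr// ltr1n.
Qed.

Lemma within_bounded (X : R -> V) (t : R) : {within `[0, t], continuous X} ->
  exists2 r, 0 <= r & forall s, s \in `[0, t] -> enorm (X s) <= r.
Proof.
move=> cX; have /compact_bounded[M [Mr hM]] := continuous_compact cX (segment_compact (a := 0) (b := t)).
exists (d%:R * (`|M| + 1)) => [|s st]; first by rewrite mulr_ge0// addr_ge0.
rewrite (le_trans (enorm_le_mx_norm _))// ler_wpM2l//.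
apply: (hM (`|M| + 1)); first by rewrite (le_lt_trans (ler_norm _))// ltrDl.
by exists s.
Qed.

Lemma drift_increment (b : V -> V) (X : R -> V) (t s s' eta : R) : continuous b ->
  {within `[0, t], continuous X} -> 0 <= s -> s <= s' -> s' <= t -> 0 <= eta ->
  (forall r, s <= r <= s' -> enorm (b (X r) - b (X s)) <= eta) ->
  enorm (drift_integral b X s' - drift_integral b X s - (s' - s) *: b (X s))
    <= d%:R * ((s' - s) * eta).
Proof.
move=> cb cX s0 ss' s't eta0 H; apply: enorm_le_bound => i; rewrite !mxE.
pose f r := b (X r) 0 i.
have cf : {within `[0, t], continuous f}.
  apply/subspace_continuousP => r rt; apply: (continuous_cvg _ (@coord_continuous _ _ _ 0 i _)).
  apply: (continuous_cvg _ (cb _)).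
  by move/subspace_continuousP: cX; exact.
have if_t : mu.-integrable `[0, t] (EFin \o f).
  by apply: continuous_compact_integrable => //; exact: segment_compact.
have if_s' : mu.-integrable `[0, s'] (EFin \o f).
  by apply: integrableS if_t => //; apply: subset_itvl; rewrite bnd_simp.
have if_ss' : mu.-integrable `]s, s'] (EFin \o f).
  by apply: integrableS if_s' => //; apply: subset_itvr; rewrite bnd_simp.
have -> : (\int[mu]_(r in `[0, s']) f r - \int[mu]_(r in `[0, s]) f r)%R
    = (\int[mu]_(r in `]s, s']) f r)%R.
  by apply: Rintegral_itvB => //; rewrite bnd_simp.
have ic c : mu.-integrable `]s, s'] (EFin \o (cst c : R -> R)).
  apply: (@integrableS _ _ _ mu `[s, s']%classic) => //.
    by apply: subset_itvr; rewrite bnd_simp.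
  apply: continuous_compact_integrable; first exact: segment_compact.
  by apply: continuous_subspaceT => x; exact: cvg_cst.
have mlen : fine (mu `]s, s']%classic) = s' - s.
  rewrite lebesgue_measure_itv/= lte_fin; case: ltP => //= h.
  by apply/esym/eqP; rewrite subr_eq0 eq_le h ss'.
have Hc r : `]s, s']%classic r -> `|f r - f s| <= eta.
  rewrite /= in_itv/= => /andP[sr rs'].
  have := coord_enorm (b (X r) - b (X s)) i; rewrite !mxE => /le_trans; apply.
  by apply: H; rewrite (ltW sr) rs'.
have up : \int[mu]_(r in `]s, s']) f r <= \int[mu]_(r in `]s, s']) (cst (f s + eta) r).
  apply: le_Rintegral => // r /Hc; rewrite ler_norml/= => /andP[_ h]; lra.
have lo : \int[mu]_(r in `]s, s']) (cst (f s - eta) r) <= \int[mu]_(r in `]s, s']) f r.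
  apply: le_Rintegral => // r /Hc; rewrite ler_norml/= => /andP[h _]; lra.
have Icst c : \int[mu]_(r in `]s, s']) (cst c r) = c * (s' - s).
  by rewrite /cst Rintegral_cst// mlen.
move: up lo; rewrite !Icst -/(f s).
move: (\int[mu]_(r in `]s, s']) f r) (f s) => I c; clear => up lo.
by rewrite ler_norml; apply/andP; split; lra.
Qed.

End path_regularity.

(** * Estimates for the Euler scheme *)

(** The explicit Euler scheme for [dx = b x dt + dw] with step [h], where [w k]
is the value of the noise at time [k * h]. *)
Fixpoint euler (R : realType) (d : nat) (b : 'rV[R]_d -> 'rV[R]_d) (h : R)
    (x : 'rV[R]_d) (w : nat -> 'rV[R]_d) (k : nat) : 'rV[R]_d :=
  if k is k'.+1 then
    let y := euler b h x w k' in y + h *: b y + (w k - w k')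
  else x.

Section drift_estimates.
Context (R : realType) (d : nat).
Notation V := 'rV[R]_d.
Variables (b : V -> V) (A : V -> 'M[R]_d) (C : R).
Hypothesis C0 : 0 <= C.
Hypothesis taylor : forall x u : V, enorm (b (x + u) - b x - u *m A x) <= C * enorm u ^+ 2.
Hypothesis lipA : forall x y u : V,
  enorm (u *m A x - u *m A y) <= C * enorm u * enorm (x - y).

Definition growth_const : R := \sum_i enorm (row i (A 0)).

Lemma growth_const_ge0 : 0 <= growth_const.
Proof. by apply: sumr_ge0 => i _; exact: enorm_ge0. Qed.

Lemma jacobian_growth (x u : V) :
  enorm (u *m A x) <= (growth_const + C * enorm x) * enorm u.
Proof.
rewrite -[u *m A x](subrK (u *m A 0)) (le_trans (ler_enormD _ _))//.
rewrite [leRHS]mulrDl addrC lerD ?enorm_mulmx//.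
by rewrite (le_trans (lipA _ _ _))// subr0 mulrAC.
Qed.

Lemma drift_growth (x u : V) :
  enorm (b (x + u) - b x) <= (growth_const + C * enorm x + C * enorm u) * enorm u.
Proof.
rewrite -[b (x + u) - b x](subrK (u *m A x)) (le_trans (ler_enormD _ _))//.
rewrite mulrDl addrC lerD ?jacobian_growth//.
by rewrite (le_trans (taylor _ _))// expr2 mulrA.
Qed.

Lemma drift_lipschitz (r : R) (x y : V) : enorm x <= r -> enorm y <= r ->
  enorm (b x - b y) <= (growth_const + 3 * C * r) * enorm (x - y).
Proof.
move=> xr yr; have := drift_growth y (x - y).
rewrite [y + _]addrC subrK => /le_trans; apply.
rewrite ler_wpM2r ?enorm_ge0// -addrA lerD2l -mulrDr mulrAC [leRHS]mulrC ler_wpM2l//.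
by have := ler_enormB x y; lra.
Qed.

(** Summing the first-order expansion of the drift along a segment cut into
many pieces makes the quadratic remainders disappear. *)
Lemma drift_one_sided (lam : R) :
  (forall x v : V, dot v (v *m A x) <= - lam * enorm v ^+ 2) ->
  forall x y, dot (x - y) (b x - b y) <= - lam * enorm (x - y) ^+ 2.
Proof.
move=> hA x y; set u := x - y.
suff H n : dot u (b x - b y) <= - lam * enorm u ^+ 2 + C * enorm u ^+ 3 / n.+1%:R.
  apply/ler_addgt0Pr => e e0.
  have [n hn] : exists n : nat, C * enorm u ^+ 3 / n.+1%:R <= e.
    exists (Num.truncn (C * enorm u ^+ 3 / e)).
    rewrite ler_pdivrMr ?ltr0n// -ler_pdivrMl// mulrC.
    exact: ltW (truncnS_gt _).
  by rewrite (le_trans (H n))// lerD2l.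
pose s : R := n.+1%:R^-1.
have s0 : 0 < s by rewrite invr_gt0 ltr0n.
have ns : n.+1%:R * s = 1 by rewrite mulfV// pnatr_eq0.
pose z (k : nat) : V := y + (k%:R * s) *: u.
have -> : b x - b y = \sum_(k < n.+1) (b (z k.+1) - b (z k)).
  rewrite -(big_mkord xpredT (fun k => b (z k.+1) - b (z k))) telescope_sumr//.
  by rewrite /z ns mul0r scale0r addr0 scale1r [y + u]addrC subrK.
rewrite dot_sumr.
have -> : - lam * enorm u ^+ 2 + C * enorm u ^+ 3 / n.+1%:R =
    \sum_(k < n.+1) (- lam * enorm u ^+ 2 * s + C * enorm u ^+ 3 * s ^+ 2).
  rewrite sumr_const card_ord -[RHS]mulr_natl -/s; move: ns.
  set N := n.+1%:R => ns.
  have -> : N * (- lam * enorm u ^+ 2 * s + C * enorm u ^+ 3 * s ^+ 2) =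
    (N * s) * (- lam * enorm u ^+ 2 + C * enorm u ^+ 3 * s) by ring.
  by rewrite ns mul1r.
apply: ler_sum => k _.
have -> : z k.+1 = z k + s *: u by rewrite /z -(natr1 k) mulrDl mul1r scalerDl addrA.
rewrite -[b (z k + _) - _](subrK (s *: u *m A (z k))) dotDr addrC lerD//.
  by rewrite -scalemxAl dotZr mulrC; apply: ler_wpM2r; [exact: ltW|exact: hA].
apply: le_trans (dot_le_enorm _ _) _.
have -> : C * enorm u ^+ 3 * s ^+ 2 = enorm u * (C * (s * enorm u) ^+ 2) by ring.
rewrite ler_wpM2l ?enorm_ge0// (le_trans (taylor _ _))//.
by rewrite enormZ gtr0_norm.
Qed.

(** The one-sided bound contracts at first order in [h], while the Lipschitz
bound controls the term of order [h ^ 2]. *)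
Lemma euler_step_contraction (lam K h : R) (x y : V) : 0 <= h ->
  dot (x - y) (b x - b y) <= - lam * enorm (x - y) ^+ 2 ->
  enorm (b x - b y) <= K * enorm (x - y) ->
  enorm ((x + h *: b x) - (y + h *: b y)) ^+ 2
    <= expR (h * (h * K ^+ 2 - 2 * lam)) * enorm (x - y) ^+ 2.
Proof.
move=> h0 ol lb.
have -> : (x + h *: b x) - (y + h *: b y) = (x - y) + h *: (b x - b y).
  by rewrite scalerBr opprD addrACA.
move: ol lb; move: (x - y) (b x - b y) => u v ol lb.
rewrite sqr_enorm !(dotDl, dotDr, dotZl, dotZr) (dotC v) -!sqr_enorm.
apply: (@le_trans _ _ ((1 + h * (h * K ^+ 2 - 2 * lam)) * enorm u ^+ 2)); last first.
  by rewrite ler_wpM2r ?sqr_ge0// expR_ge1Dx.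
have lb2 : enorm v ^+ 2 <= K ^+ 2 * enorm u ^+ 2.
  rewrite -exprMn ler_pXn2r ?nnegrE ?enorm_ge0//.
  by rewrite (le_trans _ lb)// enorm_ge0.
have h1 := ler_wpM2l h0 ol.
have h2 := ler_wpM2l (mulr_ge0 h0 h0) lb2.
move: h1 h2; set D := dot _ _; set a := enorm u ^+ 2; set c := enorm _ ^+ 2.
clearbody D a c; clear => h1 h2; lra.
Qed.

Lemma euler_contraction (lam K h r : R) (x y : V) (w : nat -> V) (n : nat) : 0 <= h ->
  (forall x y, dot (x - y) (b x - b y) <= - lam * enorm (x - y) ^+ 2) ->
  (forall x y, enorm x <= r -> enorm y <= r -> enorm (b x - b y) <= K * enorm (x - y)) ->
  (forall k, (k <= n)%N -> enorm (euler b h x w k) <= r) ->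
  (forall k, (k <= n)%N -> enorm (euler b h y w k) <= r) ->
  enorm (euler b h x w n - euler b h y w n) ^+ 2
    <= expR (n%:R * (h * (h * K ^+ 2 - 2 * lam))) * enorm (x - y) ^+ 2.
Proof.
move=> h0 ol lb; elim: n => [_ _|n ih bx by_].
  by rewrite mul0r expR0 mul1r.
rewrite /= opprD addrACA subrr addr0.
have xr := bx n (leqnSn n); have yr := by_ n (leqnSn n).
apply: le_trans (euler_step_contraction h0 (ol _ _) (lb _ _ xr yr)) _.
have -> : n.+1%:R * (h * (h * K ^+ 2 - 2 * lam)) =
    h * (h * K ^+ 2 - 2 * lam) + n%:R * (h * (h * K ^+ 2 - 2 * lam)).
  by rewrite -natr1 mulrDl mul1r [LHS]addrC.
rewrite expRD -mulrA ler_wpM2l ?expR_ge0//.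
apply: ih => k kn; [apply: bx|apply: by_]; exact: leqW.
Qed.

(** A discrete Gronwall estimate, with a bootstrap: the drift is only locally
Lipschitz, but as long as the error is below [1] the scheme remains in the ball
of radius [r + 1] where [K] applies, and then the error stays below [1]. *)
Lemma euler_tracks (X w : nat -> V) (n : nat) (h r K eta : R) :
  0 <= h -> 0 <= K -> 0 <= eta ->
  (forall x y, enorm x <= r + 1 -> enorm y <= r + 1 ->
     enorm (b x - b y) <= K * enorm (x - y)) ->
  (forall k, (k <= n)%N -> enorm (X k) <= r) ->
  (forall k, (k < n)%N ->
     enorm (X k.+1 - X k - h *: b (X k) - (w k.+1 - w k)) <= h * eta) ->
  n%:R * h * eta * expR (n%:R * h * K) <= 1 ->
  forall k, (k <= n)%N ->
    enorm (X k - euler b h (X 0) w k) <= n%:R * h * eta * expR (n%:R * h * K).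
Proof.
move=> h0 K0 eta0 lb Xr cons small k kn.
have step j : (j <= n)%N ->
    enorm (X j - euler b h (X 0) w j) <= j%:R * h * eta * expR (j%:R * h * K).
  elim: j => [_|j ih jn]; first by rewrite /= subrr enorm0 !mul0r.
  have jn' := ltnW jn; have {}ih := ih jn'.
  set E := euler b h (X 0) w j in ih *.
  have e1 : enorm (X j - E) <= 1.
    apply: le_trans ih (le_trans _ small).
    have jnR : j%:R <= n%:R :> R by rewrite ler_nat.
    rewrite ler_pM ?mulr_ge0 ?expR_ge0//; first by rewrite !ler_wpM2r.
    by rewrite ler_expR !ler_wpM2r.
  have Er : enorm E <= r + 1.
    rewrite -[E](subKr (X j)) (le_trans (ler_enormB _ _))// lerD//; exact: Xr.
  have Xr1 : enorm (X j) <= r + 1 by rewrite (le_trans (Xr j jn'))// lerDl.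
  have -> : X j.+1 - euler b h (X 0) w j.+1 =
     (X j.+1 - X j - h *: b (X j) - (w j.+1 - w j)) + ((X j - E) + h *: (b (X j) - b E)).
    rewrite /= -/E scalerBr; apply/rowP => i; rewrite !mxE; ring.
  rewrite (le_trans (ler_enormD _ _))//.
  have l1 : enorm ((X j - E) + h *: (b (X j) - b E)) <= expR (h * K) * enorm (X j - E).
    rewrite (le_trans (ler_enormD _ _))// enormZ ger0_norm//.
    rewrite (le_trans (lerD (lexx _) (ler_wpM2l h0 (lb _ _ Xr1 Er))))//.
    by rewrite mulrA -[X in X + _]mul1r -mulrDl ler_wpM2r ?enorm_ge0// expR_ge1Dx.
  rewrite (le_trans (lerD (cons j jn) l1))//.
  have l2 := ler_wpM2l (expR_ge0 (h * K)) ih.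
  rewrite (le_trans (lerD (lexx _) l2))//.
  have -> : j.+1%:R * h * K = h * K + j%:R * h * K by rewrite -natr1; ring.
  rewrite expRD.
  have E1 : 1 <= expR (h * K) * expR (j%:R * h * K).
    by rewrite -expRD; apply: le_trans (expR_ge1Dx _); rewrite lerDl !(addr_ge0, mulr_ge0).
  have := ler_wpM2l (mulr_ge0 h0 eta0) E1.
  rewrite -natr1; move: (expR (h * K)) (expR (j%:R * h * K)) => a c; lra.
apply: le_trans (step k kn) _.
have knR : k%:R <= n%:R :> R by rewrite ler_nat.
rewrite ler_pM ?mulr_ge0 ?expR_ge0//; first by rewrite !ler_wpM2r.
by rewrite ler_expR !ler_wpM2r.
Qed.

End drift_estimates.

(** * Convergence of the dyadic schemes *)

Definition dyadic (R : realType) (t : R) (i : nat * nat) : R := i.2%:R * (t / 2 ^+ i.1).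

Section dyadic_schemes.
Context (R : realType) (d : nat).
Notation V := 'rV[R]_d.
Implicit Types (b : V -> V) (w : nat * nat -> V).

Definition euler_grid b (t : R) (x : V) w (N k : nat) : V :=
  euler b (t / 2 ^+ N) x (fun j => w (N, j)) k.

Definition euler_end b t x w (N : nat) : V := euler_grid b t x w N (2 ^ N).

(** A uniform bound on the whole grid has to be recorded next to convergence at
the final time, since the Lipschitz constants of the drift are local. *)
Definition bounded_grid b t x w : Prop := exists m : nat, forall N, (m <= N)%N ->
  forall k, (k <= 2 ^ N)%N -> enorm (euler_grid b t x w N k) <= m%:R.

Definition scheme_converges b t x w (y : V) : Prop :=
  bounded_grid b t x w /\ (fun N => enorm (euler_end b t x w N - y)) @ \oo --> (0 : R).

Lemma dyadic_step_small (t e : R) : 0 < t -> 0 < e ->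
  exists n : nat, forall N, (n <= N)%N -> t / 2 ^+ N < e.
Proof.
move=> t0 e0; exists (Num.truncn (t / e)).+1 => N nN.
rewrite ltr_pdivrMr ?exprn_gt0// -ltr_pdivrMl// mulrC.
rewrite (lt_le_trans (truncnS_gt _))// (@le_trans _ _ N%:R) ?ler_nat//.
by rewrite -natrX ler_nat ltnW// ltn_expl.
Qed.

Lemma dyadic_mem (t : R) N k : 0 < t -> (k <= 2 ^ N)%N -> dyadic t (N, k) \in `[0, t].
Proof.
move=> t0 kN; rewrite in_itv/= /dyadic/= mulr_ge0 ?divr_ge0 ?exprn_ge0 ?(ltW t0)//=.
rewrite mulrA ler_pdivrMr ?exprn_gt0// mulrC ler_wpM2l ?(ltW t0)//.
by rewrite -natrX ler_nat.
Qed.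

Lemma dyadic_end (t : R) N : dyadic t (N, 2 ^ N)%N = t.
Proof. by rewrite /dyadic/= natrX mulrCA mulfV ?mulr1// expf_neq0// pnatr_eq0. Qed.

Section tracking.
Variables (b : V -> V) (A : V -> 'M[R]_d) (C : R).
Hypothesis C0 : 0 <= C.
Hypothesis taylor : forall x u : V, enorm (b (x + u) - b x - u *m A x) <= C * enorm u ^+ 2.
Hypothesis lipA : forall x y u : V,
  enorm (u *m A x - u *m A y) <= C * enorm u * enorm (x - y).
Hypothesis cb : continuous b.

(** The consistency error of one step is governed by the modulus of continuity
of [b \o X]; [euler_tracks] then accumulates it over [2 ^ N] steps. *)
Lemma euler_path_cvg (X W : R -> V) (t : R) : 0 < t ->
  {within `[0, t], continuous X} ->
  (forall s, s \in `[0, t] -> X s = X 0 + drift_integral b X s + W s) ->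
  forall e, 0 < e -> exists n : nat, forall N, (n <= N)%N -> forall k, (k <= 2 ^ N)%N ->
    enorm (X (dyadic t (N, k)) -
           euler_grid b t (X 0) (fun i => W (dyadic t i)) N k) <= e.
Proof.
move=> t0 cX eqX e e0.
have [r r0 Xr] := within_bounded cX.
pose K := growth_const A + 3 * C * (r + 1).
have K0 : 0 <= K by rewrite addr_ge0 ?growth_const_ge0// !mulr_ge0// addr_ge0.
(* [M] is the Gronwall constant, [eta] the consistency error that it turns into
   [e1]; the division by [d.+1] pays for the constant of [drift_increment]. *)
pose M := t * expR (t * K).
have M0 : 0 < M by rewrite mulr_gt0 ?expR_gt0.
pose e1 := Num.min e 1; have e10 : 0 < e1 by rewrite lt_min e0 ltr01.
pose eta := e1 / M; have eta0 : 0 < eta by rewrite divr_gt0.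
have d0 : 0 < d.+1%:R :> R by rewrite ltr0n.
have cbX : {within `[0, t], continuous (fun s => b (X s))}.
  apply/subspace_continuousP => s st.
  apply: (continuous_cvg _ (@cb _)).
  by move/subspace_continuousP: cX; exact.
have ed0 : 0 < eta / d.+1%:R by rewrite divr_gt0.
have [del del0 hdel] := within_uniformly_continuous cbX ed0.
have [n hn] := dyadic_step_small t0 del0.
exists n => N nN k kN.
have {}hn := hn N nN.
pose h := t / 2 ^+ N; have h0 : 0 < h by rewrite divr_gt0 ?exprn_gt0.
have nh : (2 ^ N)%N%:R * h = t by have := dyadic_end t N.
have te : t * eta * expR (t * K) = e1.
  by rewrite mulrAC -/M /eta mulrCA mulfV ?mulr1// gt_eqF.
have X0 : X 0 = X (dyadic t (N, 0)) by rewrite /dyadic/= mul0r.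
rewrite /euler_grid X0.
have e1e : e1 <= e by rewrite ge_min lexx.
apply: le_trans e1e.
have := (@euler_tracks R d b (fun k => X (dyadic t (N, k))) (fun j => W (dyadic t (N, j)))
  (2 ^ N) h r K eta (ltW h0) K0 (ltW eta0)).
rewrite nh te; apply => //.
- by move=> x y xr yr; exact: (drift_lipschitz C0 taylor lipA).
- by move=> j jN; apply: Xr; exact: dyadic_mem.
- move=> j jN.
  have s1 := dyadic_mem t0 (ltnW jN); have s2 := dyadic_mem t0 jN.
  have ss : dyadic t (N, j.+1) = dyadic t (N, j) + h.
    by rewrite /dyadic/= -natr1 mulrDl mul1r.
  have dX : X (dyadic t (N, j.+1)) - X (dyadic t (N, j)) =
      (drift_integral b X (dyadic t (N, j.+1)) - drift_integral b X (dyadic t (N, j)))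
      + (W (dyadic t (N, j.+1)) - W (dyadic t (N, j))).
    rewrite (eqX _ s1) (eqX _ s2).
    move: (drift_integral _ _ _) (drift_integral _ _ _) => p q.
    by apply/rowP => i; rewrite !mxE; ring.
  rewrite dX.
  move: s1 s2; rewrite !in_itv/= => /andP[s10 s1t] /andP[s20 s2t].
  set s := dyadic t (N, j) in ss s10 s1t *.
  set s' := dyadic t (N, j.+1) in ss s20 s2t *.
  have sh : s' - s = h by rewrite ss addrC addKr.
  rewrite addrAC addrK -[X in X *: _]sh.
  have ss' : s <= s' by rewrite ss lerDl ltW.
  rewrite (le_trans (drift_increment cb cX s10 ss' s2t (ltW ed0) _))//.
    move=> q /andP[sq qs']; rewrite enorm_distC; apply: hdel; rewrite ?in_itv/= ?s10 ?s1t//.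
      by rewrite (le_trans s10 sq) (le_trans qs' s2t).
    by rewrite distrC ger0_norm ?subr_ge0// (le_lt_trans _ hn)// -/h lerBlDl -ss.
  rewrite sh mulrCA ler_wpM2l ?(ltW h0)// mulrCA -[leRHS]mulr1 ler_wpM2l ?(ltW eta0)//.
  by rewrite ler_pdivrMr// mul1r ler_nat.
- by rewrite ge_min lexx orbT.
Qed.

Lemma path_scheme_converges (X W : R -> V) (t : R) : 0 < t ->
  {within `[0, t], continuous X} ->
  (forall s, s \in `[0, t] -> X s = X 0 + drift_integral b X s + W s) ->
  scheme_converges b t (X 0) (fun i => W (dyadic t i)) (X t).
Proof.
move=> t0 cX eqX; have H := euler_path_cvg t0 cX eqX; split.
  have [r r0 Xr] := within_bounded cX.
  have [n hn] := H 1 ltr01.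
  exists (maxn n (Num.truncn (r + 1)).+1) => N; rewrite geq_max => /andP[nN _] k kN.
  have h1 := hn N nN k kN.
  apply: (@le_trans _ _ (Num.truncn (r + 1)).+1%:R); last by rewrite ler_nat leq_maxr.
  apply: le_trans (ltW (truncnS_gt _)).
  rewrite -[euler_grid _ _ _ _ _ _](subKr (X (dyadic t (N, k)))).
  rewrite (le_trans (ler_enormB _ _))// lerD//.
  by apply: Xr; exact: dyadic_mem.
apply/cvgrPdist_le => e e0; have [n hn] := H e e0.
exists n => // N /= nN; rewrite sub0r normrN ger0_norm ?enorm_ge0// enorm_distC.
by have := hn N nN _ (leqnn _); rewrite dyadic_end.
Qed.

(** Contraction with the same noise needs no differential equation for the limit
points: the Euler schemes contract up to a factor tending to [1]. *)
Lemma scheme_contraction (lam t : R) (x y x' y' : V) w : 0 < t ->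
  (forall x v : V, dot v (v *m A x) <= - lam * enorm v ^+ 2) ->
  scheme_converges b t x w x' -> scheme_converges b t y w y' ->
  enorm (x' - y') <= expR (- lam * t) * enorm (x - y).
Proof.
move=> t0 hA [[m1 b1] c1] [[m2 b2] c2].
pose m := maxn m1 m2; pose r : R := m%:R.
pose K := growth_const A + 3 * C * r.
pose ex N := enorm (euler_end b t x w N - x').
pose ey N := enorm (euler_end b t y w N - y').
pose q (h : R) := expR (- lam * t + h * (t * K ^+ 2 / 2)) * enorm (x - y).
have key N : (m <= N)%N -> enorm (x' - y') <= ex N + ey N + q (t / 2 ^+ N).
  move=> mN; pose h := t / 2 ^+ N.
  have h0 : 0 <= h by rewrite divr_ge0 ?exprn_ge0 ?(ltW t0).
  have nh : (2 ^ N)%N%:R * h = t by have := dyadic_end t N.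
  have [m1N m2N] : (m1 <= N)%N /\ (m2 <= N)%N by move: mN; rewrite geq_max => /andP.
  have e12 : enorm (euler_end b t x w N - euler_end b t y w N) <= q h.
    have mr1 : (m1%:R : R) <= r by rewrite ler_nat leq_maxl.
    have mr2 : (m2%:R : R) <= r by rewrite ler_nat leq_maxr.
    have := @euler_contraction R d b lam K h r x y (fun j => w (N, j)) (2 ^ N) h0
      (drift_one_sided taylor hA).
    move=> /(_ (fun x y => drift_lipschitz C0 taylor lipA (r := r) (x := x) (y := y))).
    move=> /(_ (fun k kN => le_trans (b1 N m1N k kN) mr1)).
    move=> /(_ (fun k kN => le_trans (b2 N m2N k kN) mr2)).
    rewrite mulrA nh => H.
    rewrite -(ler_pXn2r (n := 2)) ?nnegrE ?enorm_ge0 ?mulr_ge0 ?expR_ge0 ?enorm_ge0//.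
    rewrite (le_trans H)// exprMn ler_wpM2r ?sqr_ge0//.
    by rewrite [leRHS]expr2 -expRD ler_expR le_eqVlt; apply/orP; left; apply/eqP; field.
  have -> : x' - y' = (euler_end b t x w N - euler_end b t y w N)
      - (euler_end b t x w N - x') + (euler_end b t y w N - y').
    by apply/rowP => i; rewrite !mxE; ring.
  have := ler_enormD (euler_end b t x w N - euler_end b t y w N
      - (euler_end b t x w N - x')) (euler_end b t y w N - y').
  have := ler_enormB (euler_end b t x w N - euler_end b t y w N) (euler_end b t x w N - x').
  move: e12; rewrite /ex /ey -/h.
  move: (enorm _) (enorm _) (enorm _) (enorm _) (enorm _) (q h); clear; move=> *; lra.
have ch : (fun N : nat => t / 2 ^+ N) @ \oo --> (0 : R).
  apply/cvgrPdist_lt => e e0; have [n hn] := dyadic_step_small t0 e0.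
  exists n => // N /= nN; rewrite sub0r normrN ger0_norm ?hn//.
  by rewrite divr_ge0 ?exprn_ge0 ?(ltW t0).
have cq : q (t / 2 ^+ N) @[N --> \oo] --> q 0.
  apply: cvgM; last exact: cvg_cst.
  apply: (continuous_cvg _ (@continuous_expR _ _)).
  apply: cvgD; first exact: cvg_cst.
  by apply: cvgM => //; exact: cvg_cst.
have cs : ex N + ey N + q (t / 2 ^+ N) @[N --> \oo] --> 0 + 0 + q 0.
  by apply: cvgD => //; exact: cvgD.
rewrite !add0r in cs.
have -> : expR (- lam * t) * enorm (x - y) = q 0 by rewrite /q mul0r addr0.
apply: (ler_cvg_to _ cs); last by exists m => // N; exact: key.
exact: cvg_cst.
Qed.

End tracking.

End dyadic_schemes.

(** * Expansion for small noise *)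

Section small_noise.
Context (R : realType) (d : nat).
Notation V := 'rV[R]_d.
Variables (b : V -> V) (A : V -> 'M[R]_d) (C : R).
Hypothesis C0 : 0 <= C.
Hypothesis taylor : forall x u : V, enorm (b (x + u) - b x - u *m A x) <= C * enorm u ^+ 2.
Hypothesis lipA : forall x y u : V,
  enorm (u *m A x - u *m A y) <= C * enorm u * enorm (x - y).

(** What is bounded by induction is the scheme minus its noise, which moves by
at most [h * beta] at each step. *)
Lemma euler_confined (x z : V) (r beta h : R) (w : nat -> V) (n : nat) :
  0 <= h -> 0 <= beta ->
  (forall y, enorm (y - x) <= r -> enorm (b y) <= beta) ->
  enorm (z - x) <= r / 3 -> n%:R * h * beta <= r / 3 ->
  (forall k, (k <= n)%N -> enorm (w k - w 0%N) <= r / 3) ->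
  forall k, (k <= n)%N -> enorm (euler b h z w k - x) <= r.
Proof.
move=> h0 beta0 bb zx small wr.
have conf k : (k <= n)%N ->
    enorm (euler b h z w k - z - (w k - w 0%N)) <= k%:R * h * beta ->
    enorm (euler b h z w k - x) <= r.
  move=> kn H; rewrite -[_ - x](subrK (euler b h z w k - z - (w k - w 0%N))).
  have -> : euler b h z w k - x - (euler b h z w k - z - (w k - w 0%N)) =
      (w k - w 0%N) + (z - x) by apply/rowP => i; rewrite !mxE; ring.
  have kb : k%:R * h * beta <= r / 3.
    by apply: le_trans small; rewrite !ler_wpM2r// ler_nat.
  have := ler_enormD (w k - w 0%N + (z - x)) (euler b h z w k - z - (w k - w 0%N)).
  have := ler_enormD (w k - w 0%N) (z - x).
  have := wr k kn; move: H kb zx; clear; move: (enorm _) (enorm _) => p1 p2.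
  move: (enorm _) (enorm _) (enorm _) => p3 p4 p5; move: (_ * beta) => p6 *; lra.
suff H k : (k <= n)%N -> enorm (euler b h z w k - z - (w k - w 0%N)) <= k%:R * h * beta.
  by move=> k kn; exact: conf kn (H k kn).
elim: k => [_|k ih kn]; first by rewrite /= !subrr ?subr0 enorm0 !mul0r.
have kn' := ltnW kn; have {}ih := ih kn'.
have Er := conf k kn' ih.
have -> : euler b h z w k.+1 - z - (w k.+1 - w 0%N) =
   (euler b h z w k - z - (w k - w 0%N)) + h *: b (euler b h z w k).
  by apply/rowP => i; rewrite /= !mxE; ring.
rewrite (le_trans (ler_enormD _ _))// -natr1 !mulrDl mul1r lerD//.
by rewrite enormZ ger0_norm// ler_wpM2l// bb.
Qed.

(** While the noise is small, both schemes stay near [x], where the linear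
part of the drift dominates: their difference grows like [1 + t q]. *)
Lemma euler_expansion (x v : V) (eps : R) : enorm v = 1 -> 0 < eps ->
  exists rho del t0 : R, [/\ 0 < rho, 0 < del, 0 < t0 &
  forall (t h : R) (n : nat) (w : nat -> V), 0 < t -> t < t0 -> 0 <= h -> n%:R * h = t ->
    (forall k, (k <= n)%N -> enorm (w k - w 0%N) <= rho) ->
    [/\ enorm (euler b h x w n - x) <= 1,
        enorm (euler b h (x + del *: v) w n - x) <= 1 &
        del * (1 + t * (dot v (v *m A x) - eps)) <=
          dot v (euler b h (x + del *: v) w n - euler b h x w n)]].
Proof.
move=> v1 eps0; set q := dot v (v *m A x).
pose C1 := C + 1; have C10 : 0 < C1 by rewrite ltr_wpDl.
(* Three errors are made in replacing the increment of [b] between the two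
   schemes by [del *: v *m A x]; each of [r], [del] and [t0] below makes one of
   them at most [del * eps / 3]. *)
pose r := Num.min 1 (eps / (6 * C1)).
have r0 : 0 < r by rewrite lt_min ltr01 divr_gt0 ?mulr_gt0.
have r1 : r <= 1 by rewrite ge_min lexx.
have rC : 2 * C * r <= eps / 3.
  have : r <= eps / (6 * C1) by rewrite ge_min lexx orbT.
  rewrite ler_pdivlMr ?mulr_gt0// => h; move: h; rewrite /C1; move: (ltW r0) C0.
  clear => *; nra.
pose K := growth_const A + 3 * C * (enorm x + 1).
have G0 := growth_const_ge0 A.
have K0 : 0 <= K by rewrite addr_ge0// mulr_ge0 ?addr_ge0 ?enorm_ge0 ?mulr_ge0.
(* A bound for [b] on the unit ball around [x]. *)
pose beta := enorm (b x) + (growth_const A + C * enorm x + C).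
have beta0 : 0 <= beta by rewrite !addr_ge0 ?enorm_ge0// mulr_ge0 ?enorm_ge0.
pose del := Num.min (r / 3) (eps / (12 * C1)).
have del0 : 0 < del by rewrite lt_min divr_gt0//= divr_gt0// mulr_gt0.
have delC : 4 * C * del <= eps / 3.
  have : del <= eps / (12 * C1) by rewrite ge_min lexx orbT.
  rewrite ler_pdivlMr ?mulr_gt0// => h; move: h; rewrite /C1; move: (ltW del0) C0.
  clear => *; nra.
have delr : del <= r / 3 by rewrite ge_min lexx.
pose t0 := Num.min (Num.min (eps / (6 * (K ^+ 2 + 1))) (r / (3 * (beta + 1))))
  (1 / (2 * (K + 1))).
have K21 : 0 < K ^+ 2 + 1 by rewrite ltr_wpDl// sqr_ge0.
have K1 : 0 < K + 1 by rewrite ltr_wpDl.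
have beta1 : 0 < beta + 1 by rewrite ltr_wpDl.
have t00 : 0 < t0 by rewrite !lt_min !divr_gt0 ?mulr_gt0.
exists (r / 3), del, t0; split; rewrite ?divr_gt0// => t h n w tp tt0 h0 nh wr.
move: tt0; rewrite !lt_min => /andP[/andP[/ltW tt1 /ltW tt2] /ltW tt3].
have tK2 : 2 * K ^+ 2 * t <= eps / 3.
  move: tt1; rewrite ler_pdivlMr ?mulr_gt0//; move: (ltW tp); clear; nra.
have tbeta : n%:R * h * beta <= r / 3.
  rewrite nh; move: tt2; rewrite ler_pdivlMr ?mulr_gt0//; move: (ltW tp); clear; nra.
have tK : 2 * K * t <= 1.
  move: tt3; rewrite ler_pdivlMr ?mulr_gt0//; move: (ltW tp); clear; nra.
set y := x + del *: v.
have bb z : enorm (z - x) <= r -> enorm (b z) <= beta.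
  move=> zr; rewrite -[b z](subrK (b x)) addrC (le_trans (ler_enormD _ _))// lerD2l.
  have := drift_growth taylor lipA x (z - x).
  rewrite [x + _]addrC subrK => /le_trans; apply.
  have zr1 : enorm (z - x) <= 1 by exact: le_trans r1.
  rewrite -[leRHS]mulr1 ler_pM ?enorm_ge0// ?addr_ge0 ?mulr_ge0 ?enorm_ge0//.
  by rewrite lerD2l -[leRHS]mulr1 ler_wpM2l.
have cx := euler_confined h0 beta0 bb (z := x) _ tbeta wr.
have {}cx k : (k <= n)%N -> enorm (euler b h x w k - x) <= r.
  by apply: cx; rewrite subrr enorm0 divr_ge0// ltW.
have yx : y - x = del *: v by rewrite /y addrC addKr.
have ndel : enorm (del *: v) = del by rewrite enormZ v1 mulr1 gtr0_norm.
have cy k : (k <= n)%N -> enorm (euler b h y w k - x) <= r.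
  by apply: (euler_confined h0 beta0 bb (z := y) _ tbeta wr); rewrite yx ndel.
split; [by rewrite (le_trans (cx _ _))|by rewrite (le_trans (cy _ _))|].
pose e k := euler b h y w k - euler b h x w k.
have eS k : e k.+1 = e k + h *: (b (euler b h y w k) - b (euler b h x w k)).
  by rewrite /e; apply/rowP => i; rewrite /= !mxE; ring.
have e0 : e 0%N = del *: v by rewrite /e /= yx.
have lip k : (k <= n)%N ->
    enorm (b (euler b h y w k) - b (euler b h x w k)) <= K * enorm (e k).
  move=> kn; apply: (drift_lipschitz C0 taylor lipA).
    by rewrite -[euler _ _ _ _ _](subrK x) (le_trans (ler_enormD _ _))// addrC lerD2l
      (le_trans (cy k kn)).
  by rewrite -[euler _ _ _ _ _](subrK x) (le_trans (ler_enormD _ _))// addrC lerD2l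
      (le_trans (cx k kn)).
have hk k : (k <= n)%N -> k%:R * h <= t.
  by move=> kn; rewrite -nh ler_wpM2r// ler_nat.
have half k : (k <= n)%N -> enorm (e k - e 0%N) <= 2 * K * del * (k%:R * h) ->
    enorm (e k) <= 2 * del.
  move=> kn H; rewrite -[e k](subrK (e 0%N)) (le_trans (ler_enormD _ _))//.
  rewrite e0 ndel in H *.
  have h2 : 2 * K * del * (k%:R * h) <= del.
    rewrite [leLHS]mulrAC -[leRHS]mul1r ler_wpM2r ?(ltW del0)//.
    by apply: le_trans tK; rewrite ler_wpM2l ?mulr_ge0// hk.
  by move: H h2; clear; lra.
have dev k : (k <= n)%N -> enorm (e k - e 0%N) <= 2 * K * del * (k%:R * h).
  elim: k => [_|k ih kn]; first by rewrite subrr enorm0 mul0r mulr0.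
  have kn' := ltnW kn; have {}ih := ih kn'; have ek := half k kn' ih.
  rewrite eS addrAC (le_trans (ler_enormD _ _))//.
  have -> : 2 * K * del * (k.+1%:R * h) = 2 * K * del * (k%:R * h) + h * (K * (2 * del)).
    by rewrite -natr1; ring.
  rewrite lerD// enormZ ger0_norm// ler_wpM2l// (le_trans (lip k kn'))//.
  by rewrite ler_wpM2l.
have ek2 k : (k <= n)%N -> enorm (e k) <= 2 * del by move=> kn; exact: half (dev k kn).
have slope k : (k <= n)%N ->
    del * (q - eps) <= dot v (b (euler b h y w k) - b (euler b h x w k)).
  move=> kn; set X := euler b h x w k.
  have -> : euler b h y w k = X + e k by rewrite /e addrC subrK.
  have xr := cx k kn; rewrite -/X in xr.
  have -> : b (X + e k) - b X = del *: (v *m A x) + ((e k - e 0%N) *m A x)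
      + (e k *m A X - e k *m A x) + (b (X + e k) - b X - e k *m A X).
    rewrite e0 mulmxBl -scalemxAl; move: (b _ - b _) (v *m _) (e k *m _) (e k *m _).
    by move=> *; apply/rowP => i; rewrite !mxE; ring.
  have vn u : - enorm u <= dot v u.
    by have := normr_dot v u; rewrite v1 mul1r ler_norml => /andP[].
  have ekd := ek2 k kn.
  have g1 : enorm ((e k - e 0%N) *m A x) <= del * (eps / 3).
    have KJ : growth_const A + C * enorm x <= K.
      rewrite lerD2l -mulrA [3 * _]mulr_natl; have := mulr_ge0 C0 (enorm_ge0 x).
      have := C0; lra.
    rewrite (le_trans (jacobian_growth lipA _ _))//.
    rewrite (le_trans (ler_wpM2r (enorm_ge0 _) KJ))//.
    rewrite (le_trans (ler_wpM2l K0 (dev k kn)))//.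
    have := ler_wpM2l K0 (ler_wpM2l K0 (hk k kn)); move: tK2 (ltW del0); clear; nra.
  have g2 : enorm (e k *m A X - e k *m A x) <= del * (eps / 3).
    rewrite (le_trans (lipA _ _ _))//.
    have := ler_pM (enorm_ge0 (e k)) (enorm_ge0 (X - x)) ekd xr.
    move: rC (ltW del0) C0; clear; move: (enorm _) (enorm _) => *; nra.
  have g3 : enorm (b (X + e k) - b X - e k *m A X) <= del * (eps / 3).
    rewrite (le_trans (taylor _ _))//.
    have := ler_pM (enorm_ge0 (e k)) (enorm_ge0 (e k)) ekd ekd; rewrite -expr2.
    move: delC (ltW del0) C0; clear; move: (enorm _ ^+ 2) => *; nra.
  move: g1 g2 g3.
  move: (_ *m A x) (e k *m A X - _) (b (X + e k) - b X - _) => u1 u2 u3 g1 g2 g3.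
  rewrite !dotDr dotZr -/q.
  have := vn u1; have := vn u2; have := vn u3; lra.
have grow k : (k <= n)%N -> del * (1 + k%:R * h * (q - eps)) <= dot v (e k).
  elim: k => [_|k ih kn].
    by rewrite e0 dotZr -sqr_enorm v1 expr1n mul0r mul0r addr0.
  rewrite eS dotDr dotZr; have := ih (ltnW kn); have := ler_wpM2l h0 (slope k (ltnW kn)).
  rewrite -natr1; clear; move: (dot _ _) (dot _ _) => *; lra.
by rewrite -nh; exact: grow.
Qed.

End small_noise.

(** * The curvature as a supremum *)

Section curvature.
Context (R : realType) (d : nat).
Notation V := 'rV[R]_d.
Variables (b : V -> V) (A : V -> 'M[R]_d) (C : R).
Hypothesis taylor : forall x u : V, enorm (b (x + u) - b x - u *m A x) <= C * enorm u ^+ 2.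

Let rayleigh : set R :=
  [set q : R | exists x v : V, enorm v = 1 /\ q = dot v (v *m A x)].

(** The quotient of [ol] at [x + s v] and [x] differs from the Rayleigh quotient
by at most [C * s]. *)
Lemma one_sided_rayleigh (L : R) (x v : V) :
  (forall x y, dot (x - y) (b x - b y) <= L * enorm (x - y) ^+ 2) ->
  enorm v = 1 -> dot v (v *m A x) <= L.
Proof.
move=> ol v1; apply/ler_addgt0Pr => e e0.
pose C1 := `|C| + 1; have C10 : 0 < C1 by rewrite ltr_wpDl.
pose s := e / C1; have s0 : 0 < s by rewrite divr_gt0.
have sC : C * s <= e.
  rewrite /s mulrCA -[leRHS]mulr1 ler_wpM2l ?(ltW e0)// ler_pdivrMr// mul1r.
  by rewrite (le_trans (ler_norm _))// lerDl.
have ns : enorm (s *: v) = s by rewrite enormZ v1 mulr1 gtr0_norm.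
have h1 := ol (x + s *: v) x; rewrite [x + _]addrC addrK ns in h1.
have h2 := taylor x (s *: v); rewrite [x + _]addrC ns in h2.
have h3 := dot_le_enorm (s *: v) (- (b (s *: v + x) - b x - s *: v *m A x)).
rewrite enormN ns in h3.
have h4 := le_trans h3 (ler_wpM2l (ltW s0) h2).
have h5 : s * (s * dot v (v *m A x)) <= s * (s * (L + e)).
  have -> : s * (s * dot v (v *m A x)) = dot (s *: v) (s *: v *m A x).
    by rewrite -scalemxAl dotZl dotZr.
  have h6 : s * (C * s ^+ 2) <= s * (s * e) by rewrite expr2 ler_wpM2l ?(ltW s0)// mulrCA ler_wpM2l// (ltW s0).
  move: h4; rewrite dotNr dotDr dotNr opprD opprK => h4.
  move: h1 h4 h6; move: (dot _ _) (dot _ _) => p q; lra.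
by move: h5; rewrite !ler_pM2l.
Qed.

Lemma rayleigh_has_sup (L : R) : (0 < d)%N ->
  (forall x y, dot (x - y) (b x - b y) <= L * enorm (x - y) ^+ 2) -> has_sup rayleigh.
Proof.
move=> d0 ol; split.
  pose v : V := delta_mx 0 (Ordinal d0).
  by exists (dot v (v *m A 0)), 0, v; split => //; exact: enorm_delta.
by exists L => _ [x [v [v1 ->]]]; exact: one_sided_rayleigh.
Qed.

Lemma rayleigh_le_sup : has_sup rayleigh ->
  forall x v : V, dot v (v *m A x) <= sup rayleigh * enorm v ^+ 2.
Proof.
move=> hs x v; have [/enorm_eq0 ->|v0] := eqVneq (enorm v) 0.
  by rewrite dot0l enorm0 expr0n mulr0.
have vp : 0 < enorm v by rewrite lt_neqAle eq_sym v0 enorm_ge0.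
pose u := (enorm v)^-1 *: v.
have u1 : enorm u = 1 by rewrite enormZ gtr0_norm ?invr_gt0// mulVf.
have -> : v = enorm v *: u by rewrite scalerA mulfV// scale1r.
rewrite enormZ u1 mulr1 gtr0_norm// -scalemxAl dotZl dotZr mulrA -expr2 mulrC.
rewrite ler_wpM2r ?sqr_ge0//.
by apply: (ub_le_sup hs.2); exists x, u.
Qed.

Lemma rayleigh_adherent : has_sup rayleigh -> forall e, 0 < e ->
  exists x v : V, enorm v = 1 /\ sup rayleigh - e < dot v (v *m A x).
Proof.
move=> hs e e0; have [_ [x [v [v1 ->]]] h] := sup_adherent e0 hs.
by exists x, v.
Qed.

End curvature.

(** * Borel sets of vectors *)

Section measurable_vectors.
Context (R : realType) (d : nat).
Notation V := 'rV[R]_d.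

Lemma open_measurable_vector (U : set V) : open U -> measurable U.
Proof. by move=> oU; apply: sub_sigma_algebra. Qed.

Lemma measurable_coord (i : 'I_d) : measurable_fun setT (fun v : V => v 0 i).
Proof.
apply: (measurability _ (RGenOInfty.measurableE R)) => _ [_ [x ->] <-].
rewrite setTI; apply: open_measurable_vector.
apply: open_comp => [v _|]; first exact: coord_continuous.
rewrite [X in open X](_ : _ = [set y | x < y]); first exact: open_gt.
by apply/seteqP; split => y /=; rewrite in_itv/= andbT.
Qed.

(** Open sets of vectors are countable unions of rational boxes, so Borel
measurability can be tested coordinate by coordinate. *)
Lemma measurable_vector dT (T : measurableType dT) (f : T -> V) :
  (forall i, measurable_fun setT (fun x => f x 0 i)) -> measurable_fun setT f.
Proof.
move=> mf; apply: (measurability (@open V)) => // _ [U oU <-].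
pose box (i : 'rV[rat]_d * nat) : set V := ball (map_mx ratr i.1 : V) (i.2.+1%:R^-1 : R).
have -> : U = \bigcup_i (if `[< box i `<=` U >] then box i else set0).
  apply/seteqP; split => [x Ux|x [i _]]; last by case: asboolP => // iU; exact: iU.
  have /nbhs_ballP[e /= e0 xeU] : nbhs x U by exact: open_nbhs_nbhs.
  (* The box of radius [r] around a rational point [r]-close to [x] is within
     [2 * r] of [x]. *)
  pose n := Num.truncn (2 / e); pose r : R := n.+1%:R^-1.
  have r0 : 0 < r by rewrite invr_gt0 ltr0n.
  have re : 2 * r < e.
    rewrite ltr_pdivrMr ?ltr0n// mulrC -ltr_pdivrMr//; exact: truncnS_gt.
  have qP (j : 'I_d) : exists q : rat, `|x 0 j - ratr q| < r.
    have [|q] := @rat_in_itvoo R (x 0 j - r) (x 0 j + r); first by lra.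
    rewrite in_itv/= => /andP[q1 q2]; exists q; rewrite ltr_norml; lra.
  have [q {}qP] := choice qP.
  have xb : box (\row_j q j, n) x.
    by split=> // i j; rewrite /ball/= !mxE (ord1 i) distrC.
  exists (\row_j q j, n) => //; rewrite asboolT// => y [_ yb].
  apply: xeU; split=> // i j; have := yb i j; have := qP j.
  rewrite /ball/= !mxE (ord1 i) => h1 h2.
  have -> : x 0 j - y 0 j = (x 0 j - ratr (q j)) + (ratr (q j) - y 0 j).
    by rewrite addrA subrK.
  by rewrite (le_lt_trans (ler_normD _ _))// (lt_trans (ltrD h1 h2))// -mulr2n -mulr_natl.
rewrite setTI preimage_bigcup; apply: countable_bigcupT_measurable => // i.
case: asboolP => _; last by rewrite preimage_set0.
have -> : f @^-1` box i = \bigcap_(j in [set: 'I_d])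
    ((fun x => f x 0 j) @^-1` ball (ratr (i.1 0 j) : R) (i.2.+1%:R^-1)).
  apply/seteqP; split => [x [_ h] j _|x h].
    by have := h 0 j; rewrite !mxE.
  split; first by rewrite invr_gt0 ltr0n.
  by move=> k j; rewrite !mxE (ord1 k); exact: h.
apply: fin_bigcap_measurable => // j _.
by rewrite -[X in measurable X]setTI; apply: mf => //; exact: measurable_ball.
Qed.

Lemma continuous_measurable_vector (g : V -> V) : continuous g -> measurable_fun setT g.
Proof.
move=> cg; apply: (measurability (@open V)) => // _ [U oU <-].
by rewrite setTI; apply: open_measurable_vector; apply: open_comp.
Qed.

Section operations.
Context dT (T : measurableType dT).
Implicit Types (f g : T -> V).

Lemma measurable_fun_coord f (i : 'I_d) : measurable_fun setT f ->
  measurable_fun setT (fun x => f x 0 i).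
Proof. by move=> mf; exact: measurableT_comp (measurable_coord i) mf. Qed.

Lemma measurable_vectorD f g : measurable_fun setT f -> measurable_fun setT g ->
  measurable_fun setT (fun x => f x + g x).
Proof.
move=> mf mg; apply: measurable_vector => i; under eq_fun do rewrite mxE.
by apply: measurable_funD; exact: measurable_fun_coord.
Qed.

Lemma measurable_vectorZ a f : measurable_fun setT f ->
  measurable_fun setT (fun x => a *: f x).
Proof.
move=> mf; apply: measurable_vector => i; under eq_fun do rewrite mxE.
by apply: measurable_funM => //; exact: measurable_fun_coord.
Qed.

Lemma measurable_vectorB f g : measurable_fun setT f -> measurable_fun setT g ->
  measurable_fun setT (fun x => f x - g x).
Proof.
move=> mf mg; apply: measurable_vectorD => //.
by under eq_fun do rewrite -scaleN1r; exact: measurable_vectorZ.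
Qed.

Lemma measurable_vector_mulmx f (M : 'M[R]_d) : measurable_fun setT f ->
  measurable_fun setT (fun x => f x *m M).
Proof.
move=> mf; apply: measurable_vector => i; under eq_fun do rewrite mxE.
apply: measurable_sum => j; apply: measurable_funM => //.
exact: measurable_fun_coord.
Qed.

Lemma measurable_vector_sum n (h : 'I_n -> T -> V) :
  (forall i, measurable_fun setT (h i)) ->
  measurable_fun setT (fun x => \sum_(i < n) h i x).
Proof.
move=> mh; apply: measurable_vector => i; under eq_fun do rewrite summxE.
by apply: measurable_sum => j; exact: measurable_fun_coord.
Qed.

Lemma measurable_fun_enorm f : measurable_fun setT f ->
  measurable_fun setT (fun x => enorm (f x)).
Proof.
move=> mf.
have ms : measurable_fun setT (@Num.sqrt R).
  by apply: continuous_measurable_fun; exact: sqrt_continuous.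
have md : measurable_fun setT (fun x => dot (f x) (f x)).
  apply: measurable_sum => j.
  by apply: measurable_funM; exact: measurable_fun_coord.
exact: (measurableT_comp ms md).
Qed.

End operations.

End measurable_vectors.

(** * Laws of families of random variables *)

Section path_space.
Context (I : eqType) dT (T : measurableType dT).

Definition cylinder : set_system (I -> T) :=
  [set C | exists (s : seq I) (A : I -> set T), (forall i, measurable (A i)) /\
     C = [set w | forall i, i \in s -> A i (w i)]].

Definition path_space := g_sigma_algebraType cylinder.

Lemma cylinder_measurable (s : seq I) (A : I -> set T) : (forall i, measurable (A i)) ->
  measurable ([set w | forall i, i \in s -> A i (w i)] : set path_space).
Proof. by move=> mA; apply: sub_sigma_algebra; exists s, A. Qed.

Lemma measurable_path_coord (i : I) : measurable_fun setT (fun w : path_space => w i).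
Proof.
move=> _ B mB; rewrite setTI.
rewrite [X in measurable X](_ : _ = [set w | forall j, j \in [:: i] -> B (w j)]).
  exact: (@cylinder_measurable _ (fun=> B)).
apply/seteqP; split => w /= h; last by apply: h; rewrite inE.
by move=> j; rewrite inE => /eqP ->.
Qed.

Lemma cylinder_preimage_measurable dO (O : measurableType dO) (X : O -> I -> T)
    (s : seq I) (A : I -> set T) :
  (forall i, measurable_fun setT (X ^~ i)) -> (forall i, measurable (A i)) ->
  measurable [set o | forall i, i \in s -> A i (X o i)].
Proof.
move=> mX mA; elim: s => [|i s ih].
  by rewrite [X in measurable X](_ : _ = setT)//; apply/seteqP; split.
rewrite [X in measurable X](_ : _ = (X ^~ i) @^-1` A i `&`
    [set o | forall i, i \in s -> A i (X o i)]).
  by apply: measurableI => //; rewrite -[X in measurable X]setTI; exact: mX.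
apply/seteqP; split => o /=.
  by move=> h; split=> [|j js]; apply: h; rewrite inE ?eqxx// js orbT.
by move=> [hi hs] j; rewrite inE => /orP[/eqP ->|]//; exact: hs.
Qed.

Lemma measurable_path dO (O : measurableType dO) (X : O -> path_space) :
  (forall i, measurable_fun setT (fun o => X o i)) -> measurable_fun setT X.
Proof.
move=> mX; apply: (@measurability _ _ O path_space setT X cylinder) => // _ [_ [s [A [mA ->]]] <-].
by rewrite setTI; exact: cylinder_preimage_measurable.
Qed.

Lemma cylinder_setI : setI_closed cylinder.
Proof.
move=> _ _ [s1 [A1 [m1 ->]]] [s2 [A2 [m2 ->]]].
exists (s1 ++ s2), (fun i => (if i \in s1 then A1 i else setT) `&`
                             (if i \in s2 then A2 i else setT)); split.
  by move=> i; apply: measurableI; case: ifP.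
apply/seteqP; split => w /=.
  by move=> [h1 h2] i is12; split; case: ifPn => // is_; [exact: h1|exact: h2].
move=> h; split => i is_; have := h i; rewrite mem_cat is_ ?orbT => /(_ isT)[] //.
Qed.

End path_space.

Section image_law.
Context (R : realType) d1 d2 (T1 : measurableType d1) (T2 : measurableType d2).
Variables (P : probability T1 R) (f : T1 -> T2) (mf : measurable_fun setT f).

(** The proof of measurability is an argument so that the structure of
probability can be attached to the term. *)
Definition image_law of measurable_fun setT f : set T2 -> \bar R := pushforward P f.

Let image_law0 : image_law mf set0 = 0%E.
Proof. by rewrite /image_law/pushforward preimage_set0 measure0. Qed.

Let image_law_ge0 A : (0 <= image_law mf A)%E.
Proof. exact: measure_ge0. Qed.

Let image_law_sigma_additive : semi_sigma_additive (image_law mf).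
Proof.
move=> F mF tF mUF; rewrite /image_law/pushforward preimage_bigcup.
apply: measure_semi_sigma_additive.
- by move=> n; rewrite -[X in measurable X]setTI; exact: mf.
- apply/trivIsetP => /= i j _ _ ij; rewrite -preimage_setI.
  by move/trivIsetP : tF => /(_ _ _ _ _ ij) ->//; rewrite preimage_set0.
- by rewrite -preimage_bigcup -[X in measurable X]setTI; exact: mf.
Qed.

HB.instance Definition _ := isMeasure.Build _ _ _
  (image_law mf) image_law0 image_law_ge0 image_law_sigma_additive.

Let image_law_setT : image_law mf setT = 1%E.
Proof. by rewrite /image_law/pushforward preimage_setT probability_setT. Qed.

HB.instance Definition _ := Measure_isProbability.Build _ _ _ (image_law mf) image_law_setT.

End image_law.

Section laws_of_families.
Context (R : realType).

(** A pi-lambda argument: finite-dimensional marginals determine the joint law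
of a family of random variables. *)
Lemma law_determined (I : eqType) dT (T : measurableType dT)
    d1 (O1 : measurableType d1) (P1 : probability O1 R) (X1 : O1 -> path_space I T)
    d2 (O2 : measurableType d2) (P2 : probability O2 R) (X2 : O2 -> path_space I T) :
  (forall i, measurable_fun setT (fun o => X1 o i)) ->
  (forall i, measurable_fun setT (fun o => X2 o i)) ->
  (forall (s : seq I) (A : I -> set T), (forall i, measurable (A i)) ->
     P1 [set o | forall i, i \in s -> A i (X1 o i)] =
     P2 [set o | forall i, i \in s -> A i (X2 o i)]) ->
  forall D : set (path_space I T), measurable D -> P1 (X1 @^-1` D) = P2 (X2 @^-1` D).
Proof.
move=> /measurable_path m1 /measurable_path m2 H D mD.
suff : image_law P1 m1 D = image_law P2 m2 D by [].
pose G := [set X | cylinder X /\ X `<=` [set: path_space I T]].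
have GE : G = @cylinder I _ T by apply/seteqP; split => [X []|X cX].
apply: (@g_sigma_algebra_measure_unique_trace _ R (path_space I T) (@cylinder I _ T) setT) => //.
- by rewrite -/G GE => X cX; exact: sub_sigma_algebra.
- by rewrite -/G GE; exact: cylinder_setI.
- exact: etrans (probability_setT P1) (esym (probability_setT P2)).
- rewrite -/G GE => _ [s [A [mA ->]]]; exact: H.
- by apply: (@le_lt_trans _ _ 1%E); [exact: probability_le1|exact: ltry].
- by rewrite -/G GE.
Qed.

Lemma probability_ae_eq d1 (O1 : measurableType d1) (P : probability O1 R) (A B : set O1) :
  measurable A -> measurable B -> {ae P, forall w, A w <-> B w} -> P A = P B.
Proof.
move=> mA mB [N [mN PN sN]].
have le C D : measurable C -> measurable D -> C `<=` D `|` N -> (P C <= P D)%E.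
  move=> mC mD CDN; apply: (@le_trans _ _ (P (D `|` N))).
    by apply: le_measure; rewrite ?inE//; exact: measurableU.
  apply: (@le_trans _ _ (P D + P N)%E); first exact: measureU2.
  by rewrite PN adde0.
apply/eqP; rewrite eq_le !le// => w Xw.
- have [Nw|Nw] := pselect (N w); [by right|left].
  apply: contrapT => Aw; apply: Nw; apply: sN => /= h; tauto.
- have [Nw|Nw] := pselect (N w); [by right|left].
  apply: contrapT => Aw; apply: Nw; apply: sN => /= h; tauto.
Qed.

End laws_of_families.

(** * Uniqueness of the Wiener law *)

Section brownian_law.
Context (R : realType) (d : nat).
Notation V := 'rV[R]_d.

Definition dyadic_path dO (O : measurableType dO) (B : R -> O -> V) (t : R) (o : O) :
  path_space (nat * nat)%type V := fun i => B (dyadic t i) o.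

Lemma dyadic_ge0 (t : R) i : 0 <= t -> 0 <= dyadic t i.
Proof. by move=> t0; rewrite /dyadic mulr_ge0 ?divr_ge0 ?exprn_ge0. Qed.

Lemma measurable_dyadic_path dO (O : measurableType dO) (P : probability O R) B (t : R) :
  0 <= t -> standard_brownian_motion P B -> measurable_fun setT (@dyadic_path _ O B t).
Proof.
move=> t0 bm; apply: measurable_path => i.
exact: bm_measurable bm _ (dyadic_ge0 _ t0).
Qed.

Lemma independent_cylinder dO (O : measurableType dO) (P : probability O R) (I : finType)
    dT (T : measurableType dT) (X : I -> O -> T) (s : seq I) (A : I -> set T) :
  mutually_independent P X -> (forall i, measurable (A i)) ->
  P [set o | forall i, i \in s -> A i (X i o)] =
  (\prod_i P (X i @^-1` (if i \in s then A i else setT)))%E.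
Proof.
move=> indX mA; rewrite -indX; last by move=> i; case: ifP.
congr (P _); apply/seteqP; split => o /= h i.
  by move=> _ /=; case: ifPn => // /h.
by move=> is_; have := h i Logic.I; rewrite /= is_.
Qed.

Context d1 (O1 : measurableType d1) (P1 : probability O1 R) (B1 : R -> O1 -> V).
Context d2 (O2 : measurableType d2) (P2 : probability O2 R) (B2 : R -> O2 -> V).
Hypothesis bm1 : standard_brownian_motion P1 B1.
Hypothesis bm2 : standard_brownian_motion P2 B2.

Lemma increment_law (s t : R) (A : set V) : 0 <= s -> s < t -> measurable A ->
  P1 ((fun o => B1 t o - B1 s o) @^-1` A) = P2 ((fun o => B2 t o - B2 s o) @^-1` A).
Proof.
move=> s0 st mA; have t0 : 0 <= t by rewrite (le_trans s0)// ltW.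
have [ind1 g1] := bm_gaussian_increments bm1 s0 st.
have [ind2 g2] := bm_gaussian_increments bm2 s0 st.
pose X1 o : path_space 'I_d R := fun i => (B1 t o - B1 s o) 0 i.
pose X2 o : path_space 'I_d R := fun i => (B2 t o - B2 s o) 0 i.
have mrow : measurable_fun setT (fun w : path_space 'I_d R => (\row_i w i : V)).
  apply: measurable_vector => i.
  rewrite [X in measurable_fun _ X](_ : _ = (fun w : path_space 'I_d R => w i)).
    exact: measurable_path_coord.
  by apply/funext => w; rewrite mxE.
pose D : set (path_space 'I_d R) := [set w | A (\row_i w i)].
have mD : measurable D by rewrite -[D]setTI; exact: mrow.
have rowE (v : V) : (\row_i v 0 i) = v by apply/rowP => i; rewrite mxE.
have -> : (fun o => B1 t o - B1 s o) @^-1` A = X1 @^-1` D.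
  by apply/seteqP; split=> o; rewrite /D/X1/= rowE.
have -> : (fun o => B2 t o - B2 s o) @^-1` A = X2 @^-1` D.
  by apply/seteqP; split=> o; rewrite /D/X2/= rowE.
apply: law_determined => //.
- by move=> i; apply: measurable_fun_coord; apply: measurable_vectorB; exact: (bm_measurable bm1).
- by move=> i; apply: measurable_fun_coord; apply: measurable_vectorB; exact: (bm_measurable bm2).
move=> l C mC; rewrite (independent_cylinder l ind1 mC) (independent_cylinder l ind2 mC).
apply: eq_bigr => i _; case: ifP => _; last by rewrite !preimage_setT !probability_setT.
by rewrite g1// g2.
Qed.

Lemma grid_increments_law (tau : nat -> R) (n : nat) (D : set (path_space 'I_n V)) :
  0 <= tau 0%N -> (forall k, tau k < tau k.+1) -> measurable D ->
  P1 ((fun o (k : 'I_n) => B1 (tau k.+1) o - B1 (tau k) o) @^-1` D) =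
  P2 ((fun o (k : 'I_n) => B2 (tau k.+1) o - B2 (tau k) o) @^-1` D).
Proof.
move=> tau0 tauS mD.
have tau_ge0 k : 0 <= tau k by elim: k => // k ih; rewrite (le_trans ih)// ltW.
have ind1 := @bm_independent_increments _ _ _ _ _ _ bm1 n tau tau0 (fun k => ltW (tauS k)).
have ind2 := @bm_independent_increments _ _ _ _ _ _ bm2 n tau tau0 (fun k => ltW (tauS k)).
apply: law_determined => //.
- by move=> k; apply: measurable_vectorB; exact: (bm_measurable bm1).
- by move=> k; apply: measurable_vectorB; exact: (bm_measurable bm2).
move=> l C mC; rewrite (independent_cylinder l ind1 mC) (independent_cylinder l ind2 mC).
apply: eq_bigr => i _; case: ifP => _; last by rewrite !preimage_setT !probability_setT.
exact: increment_law.
Qed.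

Definition refined_index (M : nat) (i : nat * nat) : nat := (i.2 * 2 ^ (M - i.1))%N.

Lemma dyadic_refine (t : R) M i : (i.1 <= M)%N ->
  dyadic t i = dyadic t (M, refined_index M i).
Proof.
move=> iM; rewrite /dyadic/refined_index/= natrM natrX.
have -> : 2 ^+ M = 2 ^+ (M - i.1) * 2 ^+ i.1 :> R by rewrite -exprD subnK.
have e1 : (2 ^+ (M - i.1) : R) != 0 by rewrite expf_neq0// pnatr_eq0.
have e2 : (2 ^+ i.1 : R) != 0 by rewrite expf_neq0// pnatr_eq0.
move: e1 e2; move: (2 ^+ _) (2 ^+ _) => p q p0 q0; field.
by rewrite p0 q0.
Qed.

Lemma refined_sum dO (O : measurableType dO) (B : R -> O -> V) (t : R) M n i o :
  (i.1 <= M)%N -> (refined_index M i <= n)%N ->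
  B (dyadic t i) o = B 0 o +
    \sum_(k < n | (k < refined_index M i)%N)
       (B (dyadic t (M, k.+1)) o - B (dyadic t (M, k : nat)) o).
Proof.
move=> iM im; rewrite (dyadic_refine t iM).
rewrite -(big_ord_widen n
  (fun k => B (dyadic t (M, k.+1)) o - B (dyadic t (M, k)) o) im).
rewrite -(big_mkord xpredT (fun k => B (dyadic t (M, k.+1)) o - B (dyadic t (M, k)) o)).
have d0 : dyadic t (M, 0%N) = 0 by rewrite /dyadic/= mul0r.
by rewrite telescope_sumr// d0 addrC subrK.
Qed.

(** Dyadic values of a Brownian path are sums of independent Gaussian
increments over one fine enough grid, hence their joint law is prescribed. *)
Lemma dyadic_path_law (t : R) (D : set (path_space (nat * nat)%type V)) : 0 < t ->
  measurable D -> P1 (dyadic_path B1 t @^-1` D) = P2 (dyadic_path B2 t @^-1` D).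
Proof.
move=> t0; apply: law_determined.
- by move=> i; apply: (bm_measurable bm1); rewrite dyadic_ge0 ?ltW.
- by move=> i; apply: (bm_measurable bm2); rewrite dyadic_ge0 ?ltW.
move=> s A mA.
pose M := \max_(i <- s) i.1; pose n := \max_(i <- s) refined_index M i.
have sM i : i \in s -> (i.1 <= M)%N by move=> is_; exact: (@leq_bigmax_seq _ _ xpredT (fun j : nat * nat => j.1)).
have sn i : i \in s -> (refined_index M i <= n)%N.
  by move=> is_; exact: (@leq_bigmax_seq _ _ xpredT (refined_index M)).
pose G (u : path_space 'I_n V) i : V := \sum_(k < n | (k < refined_index M i)%N) u k.
have mG i : measurable_fun setT (G ^~ i).
  rewrite [X in measurable_fun _ X](_ : _ = (fun u : path_space 'I_n V =>
      \sum_(k < n) (if (k < refined_index M i)%N then u k else 0))); last first.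
    by apply/funext => u; rewrite /G big_mkcond.
  apply: measurable_vector_sum => k; case: (k < _)%N; last exact: measurable_cst.
  exact: measurable_path_coord.
pose E : set (path_space 'I_n V) := [set u | forall i, i \in s -> A i (G u i)].
have mE : measurable E by exact: cylinder_preimage_measurable.
pose tau k := dyadic t (M, k).
have tau0 : 0 <= tau 0%N by rewrite dyadic_ge0 ?ltW.
have tauS k : tau k < tau k.+1.
  by rewrite /tau/dyadic/= -(natr1 k) mulrDl mul1r ltrDl divr_gt0 ?exprn_gt0.
have key dO (O : measurableType dO) (P : probability O R) B : standard_brownian_motion P B ->
    P [set o | forall i, i \in s -> A i (dyadic_path B t o i)] =
    P ((fun o (k : 'I_n) => B (tau k.+1) o - B (tau k) o) @^-1` E).
  move=> bm; apply: probability_ae_eq.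
  - apply: cylinder_preimage_measurable => // i.
    by apply: (bm_measurable bm); rewrite dyadic_ge0 ?ltW.
  - rewrite -[X in measurable X]setTI; apply: measurable_path => // k.
    by apply: measurable_vectorB; apply: (bm_measurable bm); rewrite dyadic_ge0 ?ltW.
  apply: filterS (bm_start bm) => o B0.
  suff H i : i \in s -> dyadic_path B t o i = G (fun k => B (tau k.+1) o - B (tau k) o) i.
    by split=> h i is_; have := h i is_; rewrite H.
  by move=> is_; rewrite /dyadic_path (refined_sum (n := n) _ _ _ (sM _ is_) (sn _ is_)) B0 add0r.
by rewrite (key _ _ _ _ bm1) (key _ _ _ _ bm2); exact: grid_increments_law.
Qed.

End brownian_law.

(** * The flow as a function of the initial point and the noise *)

Section scheme_measurability.
Context (R : realType) (d : nat).
Notation V := 'rV[R]_d.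
Notation W := (path_space (nat * nat)%type V).
Variables (b : V -> V) (sigma : 'M[R]_d) (t : R).
Hypothesis cb : continuous b.

Definition noise (w : W) : nat * nat -> V := fun i => w i *m sigma^T.

(** The flow of the equation at time [t], read off the dyadic values of the
Brownian path; meaningful where the Euler schemes converge. *)
Definition flow (p : V * W) : V :=
  \row_(i < d) fine (limn_esup (fun N => ((euler_end b t p.1 (noise p.2) N) 0 i)%:E)).

Definition converging : set (V * W) :=
  [set p | scheme_converges b t p.1 (noise p.2) (flow p)].

Lemma measurable_euler_grid N k :
  measurable_fun setT (fun p : V * W => euler_grid b t p.1 (noise p.2) N k).
Proof.
have mn i : measurable_fun setT (fun p : V * W => noise p.2 i).
  apply: measurable_vector_mulmx.
  exact: (measurableT_comp (measurable_path_coord i) measurable_snd).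
rewrite /euler_grid; elim: k => [|k ih] /=; first exact: measurable_fst.
apply: measurable_vectorD; last by apply: measurable_vectorB.
apply: measurable_vectorD => //; apply: measurable_vectorZ.
exact: (measurableT_comp (continuous_measurable_vector cb) ih).
Qed.

Lemma measurable_flow : measurable_fun setT flow.
Proof.
apply: measurable_vector => i.
rewrite [X in measurable_fun _ X](_ : _ = fine \o (fun p =>
    limn_esup (fun N => ((euler_end b t p.1 (noise p.2) N) 0 i)%:E))); last first.
  by apply/funext => p; rewrite mxE.
apply: measurableT_comp; first exact: fine_measurable.
apply: measurable_fun_limn_esup => N; apply/measurable_EFinP.
by apply: measurable_fun_coord; exact: measurable_euler_grid.
Qed.

Lemma measurable_sublevel dT (T : measurableType dT) (g : T -> R) (c : R) :
  measurable_fun setT g -> measurable [set x | g x <= c].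
Proof.
move=> mg; rewrite (_ : [set _ | _] = setT `&` g @^-1` `]-oo, c]%classic); first exact: mg.
by rewrite setTI; apply/seteqP; split => x /=; rewrite in_itv.
Qed.

Lemma measurable_abs_gt dT (T : measurableType dT) (g : T -> R) (c : R) :
  measurable_fun setT g -> measurable [set x | c < `|g x|].
Proof.
move=> mg; rewrite (_ : [set _ | _] = ~` [set x | `|g x| <= c]).
  apply: measurableC; apply: measurable_sublevel.
  exact: (measurableT_comp (@normr_measurable R setT) mg).
by apply/seteqP; split => x /=; rewrite ltNge => /negP.
Qed.

Lemma measurable_cvg0 dT (T : measurableType dT) (g : nat -> T -> R) :
  (forall n, measurable_fun setT (g n)) -> (forall n x, 0 <= g n x) ->
  measurable [set x | (fun n => g n x) @ \oo --> (0 : R)].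
Proof.
move=> mg g0.
rewrite (_ : [set _ | _] = \bigcap_(j in [set: nat]) \bigcup_(n in [set: nat])
    \bigcap_(N in [set N | (n <= N)%N]) [set x | g N x <= j.+1%:R^-1]).
  apply: bigcap_measurableType => j _; apply: bigcup_measurable => n _.
  by apply: bigcap_measurableType => N _; exact: measurable_sublevel.
apply/seteqP; split => x /= h.
  move=> j _; have j0 : 0 < j.+1%:R^-1 :> R by rewrite invr_gt0 ltr0n.
  move/cvgrPdist_le : h => /(_ _ j0) [n _ hn]; exists n => // N /= nN.
  by have := hn N nN; rewrite sub0r normrN ger0_norm.
apply/cvgrPdist_le => e e0.
have [n _ hn] := h (Num.truncn e^-1) Logic.I.
exists n => // N /= nN; rewrite sub0r normrN ger0_norm//.
apply: le_trans (hn N nN) _.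
by rewrite invf_ple ?posrE ?ltr0n// ltW// truncnS_gt.
Qed.

Lemma measurable_converging : measurable converging.
Proof.
rewrite (_ : converging =
  (\bigcup_(m in [set: nat]) \bigcap_(N in [set N | (m <= N)%N])
     \bigcap_(k in [set k | (k <= 2 ^ N)%N])
       [set p | enorm (euler_grid b t p.1 (noise p.2) N k) <= m%:R]) `&`
  [set p | (fun N => enorm (euler_end b t p.1 (noise p.2) N - flow p)) @ \oo --> (0 : R)]).
  apply: measurableI.
    apply: bigcup_measurable => m _; apply: bigcap_measurableType => N _.
    apply: bigcap_measurableType => k _; apply: measurable_sublevel.
    by apply: measurable_fun_enorm; exact: measurable_euler_grid.
  apply: measurable_cvg0 => [N|N p]; last exact: enorm_ge0.
  apply: measurable_fun_enorm; apply: measurable_vectorB; last exact: measurable_flow.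
  exact: measurable_euler_grid.
apply/seteqP; split => p /=.
  by move=> [[m hm] c]; split => //; exists m => // N /= mN k /= kN; exact: hm.
by move=> [[m _ hm] c]; split => //; exists m => N mN k kN; exact: hm.
Qed.

Lemma flow_eq (x : V) (w : W) (y : V) : scheme_converges b t x (noise w) y -> flow (x, w) = y.
Proof.
move=> [_ c]; apply/rowP => i; rewrite mxE /=.
have ci : (fun N => ((euler_end b t x (noise w) N) 0 i)%:E) @ \oo --> (y 0 i)%:E.
  apply: cvg_EFin; first by apply: nearW.
  apply/cvgrPdist_le => e e0; move/cvgrPdist_le : c => /(_ _ e0) [n _ hn].
  exists n => // N /= nN; apply: le_trans (hn N nN).
  rewrite sub0r normrN [leRHS]ger0_norm ?enorm_ge0// distrC.
  by have := coord_enorm (euler_end b t x (noise w) N - y) i; rewrite !mxE.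
by rewrite is_cvg_limn_esupE ?(cvg_lim _ ci)//; apply/cvg_ex; exists (y 0 i)%:E.
Qed.

Lemma converging_flow (x : V) (w : W) (y : V) : scheme_converges b t x (noise w) y ->
  converging (x, w).
Proof. by move=> h; rewrite /converging/= (flow_eq h). Qed.

End scheme_measurability.

Section joint_law.
Context (R : realType) (d : nat).
Notation V := 'rV[R]_d.
Notation W := (path_space (nat * nat)%type V).
Context d1 (O1 : measurableType d1) (P1 : probability O1 R) (B1 : R -> O1 -> V).
Hypothesis bm1 : standard_brownian_motion P1 B1.
Variables (t : R) (t0 : 0 < t).

Let mZ : measurable_fun setT (dyadic_path B1 t) := measurable_dyadic_path (ltW t0) bm1.

Definition wiener_law : probability W R := image_law P1 mZ.

Variables (b : V -> V) (sigma : 'M[R]_d) (nu : probability V R).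
Context d2 (O2 : measurableType d2) (P2 : probability O2 R) (B2 X : R -> O2 -> V).
Hypothesis sol : sde_solution b sigma nu P2 B2 X.

(** Independence of the initial condition and uniqueness of the Wiener law:
all solutions started from [nu] are driven by the same product measure. *)
Lemma initial_path_law (D : set (V * W)) : measurable D ->
  P2 ((fun o => (X 0 o, dyadic_path B2 t o)) @^-1` D) = (nu \x wiener_law)%E D.
Proof.
move=> mD; have bm2 := sol_brownian sol.
(* The initial value joins the path as the coordinate [None], so that a single
   family carries the joint law. *)
pose I := option (nat * nat).
pose Y1 (o : O2) : path_space I V := fun j => if j is Some i then dyadic_path B2 t o i else X 0 o.
pose Y2 (p : V * W) : path_space I V := fun j => if j is Some i then p.2 i else p.1.
pose split (u : path_space I V) : V * W := (u None, fun i => u (Some i)).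
have msplit : measurable_fun setT split.
  apply: measurable_fun_pair; first exact: measurable_path_coord.
  by apply: measurable_path => i; exact: measurable_path_coord.
have mE : measurable (split @^-1` D) by rewrite -[X in measurable X]setTI; exact: msplit.
have -> : (fun o => (X 0 o, dyadic_path B2 t o)) @^-1` D = Y1 @^-1` (split @^-1` D).
  by apply/seteqP; split.
have -> : (nu \x wiener_law)%E D = (nu \x wiener_law)%E (Y2 @^-1` (split @^-1` D)).
  by congr (_ _); apply/seteqP; split => -[x w].
apply: law_determined => //.
- case=> [i|]; last by apply: (sol_measurable sol).
  by apply: (bm_measurable bm2); rewrite dyadic_ge0 ?ltW.
- case=> [i|]; last exact: measurable_fst.
  exact: (measurableT_comp (measurable_path_coord i) measurable_snd).
move=> s A mA.
pose A0 := if None \in s then A None else setT.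
have mA0 : measurable A0 by rewrite /A0; case: ifP.
pose s' := pmap id s.
have s'P i : (i \in s') = (Some i \in s) by rewrite mem_pmap map_id.
pose C : set W := [set w | forall i, i \in s' -> A (Some i) (w i)].
have mC : measurable C by exact: (cylinder_measurable (T := V) s' (fun i => mA (Some i))).
have A0P (x : V) : (None \in s -> A None x) <-> A0 x.
  by rewrite /A0; case: (None \in s); split => // h; exact: h.
have -> : [set p | forall j, j \in s -> A j (Y2 p j)] = A0 `*` C.
  apply/seteqP; split => -[x w] /=.
    by move=> h; split; [apply/A0P => ?; exact: (h None)|move=> i; rewrite s'P => /h].
  by move=> [/A0P h0 hC] [i|] js; [apply: hC; rewrite s'P|exact: h0].
transitivity (nu A0 * wiener_law C)%E; last by apply/esym; exact: product_measure1E.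
have -> : wiener_law C = P2 (dyadic_path B2 t @^-1` C).
  exact: (dyadic_path_law bm1 bm2 t0 mC).
rewrite -(sol_initial_law sol mA0).
have indep := sol_initial_independent sol.
pose tau (k : 'I_(size s')) := dyadic t (nth (0, 0)%N s' k).
pose A' (k : 'I_(size s')) := A (Some (nth (0, 0)%N s' k)).
have CE : dyadic_path B2 t @^-1` C = \bigcap_k (B2 (tau k) @^-1` A' k).
  apply/seteqP; split => o /= h.
    by move=> k _; apply: h; exact: mem_nth.
  move=> i is'; have lt_i : (index i s' < size s')%N by rewrite index_mem.
  by have := h (Ordinal lt_i) Logic.I; rewrite /A'/tau/= nth_index.
have e := indep (size s') tau A0 A' (fun k => dyadic_ge0 _ (ltW t0)) mA0 (fun k => mA _).
rewrite CE -e.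
congr (P2 _); rewrite -CE; apply/seteqP; split => o /=.
  by move=> h; split; [apply/A0P => ?; exact: (h None)|move=> i; rewrite s'P => /h].
by move=> [/A0P h0 hC] [i|] js; [apply: hC; rewrite s'P|exact: h0].
Qed.

End joint_law.

(** * Laws of solutions *)

Section solution_law.
Context (R : realType) (d : nat).
Notation V := 'rV[R]_d.
Notation W := (path_space (nat * nat)%type V).
Variables (b : V -> V) (A : V -> 'M[R]_d) (C : R).
Hypothesis C0 : 0 <= C.
Hypothesis taylor : forall x u : V, enorm (b (x + u) - b x - u *m A x) <= C * enorm u ^+ 2.
Hypothesis lipA : forall x y u : V,
  enorm (u *m A x - u *m A y) <= C * enorm u * enorm (x - y).
Hypothesis cb : continuous b.
Variables (sigma : 'M[R]_d) (nu : probability V R) (t : R).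
Hypothesis t0 : 0 < t.
Context d1 (O1 : measurableType d1) (P1 : probability O1 R) (B1 : R -> O1 -> V).
Hypothesis bm1 : standard_brownian_motion P1 B1.
Context d2 (O2 : measurableType d2) (P2 : probability O2 R) (B2 X : R -> O2 -> V).
Hypothesis sol : sde_solution b sigma nu P2 B2 X.

Lemma solution_scheme_ae : {ae P2, forall o,
  scheme_converges b t (X 0 o) (noise sigma (dyadic_path B2 t o)) (X t o)}.
Proof.
apply: filterS2 (sol_continuous sol) (sol_equation sol) => o cX eX.
apply: (@path_scheme_converges R d b A C C0 taylor lipA cb (X ^~ o)
  (fun s => B2 s o *m sigma^T) t t0).
  apply: continuous_subspaceW cX => s /=; rewrite !in_itv/= andbT.
  by move=> /andP[].
by move=> s; rewrite in_itv/= => /andP[s0 _]; exact: eX.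
Qed.

Let mP2 : measurable_fun setT (fun o => (X 0 o, dyadic_path B2 t o)).
Proof.
apply: measurable_fun_pair; first exact: (sol_measurable sol).
exact: (measurable_dyadic_path (ltW t0) (sol_brownian sol)).
Qed.

(** Convergence is an event in terms of [X 0] and countably many values of the
Brownian motion; it holds almost surely where a solution is given, hence also
under the product measure, where none has been constructed. *)
Lemma converging_full :
  (nu \x wiener_law bm1 t0)%E (converging b sigma t) = 1%E.
Proof.
have mc := measurable_converging sigma t cb.
rewrite -(initial_path_law bm1 t0 sol mc) -(probability_setT P2).
apply: probability_ae_eq.
- by rewrite -[X in measurable X]setTI; exact: mP2.
- exact: measurableT.
by apply: filterS solution_scheme_ae => o h; split => // _; exact: converging_flow h.
Qed.

Lemma solution_law (D : set V) : measurable D ->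
  P2 (X t @^-1` D) = (nu \x wiener_law bm1 t0)%E (flow b sigma t @^-1` D).
Proof.
move=> mD.
have mfD : measurable (flow b sigma t @^-1` D).
  by rewrite -[X in measurable X]setTI; exact: measurable_flow.
rewrite -(initial_path_law bm1 t0 sol mfD).
apply: probability_ae_eq.
- by rewrite -[X in measurable X]setTI; exact: (sol_measurable sol (ltW t0)).
- by rewrite -[X in measurable X]setTI; exact: mP2.
by apply: filterS solution_scheme_ae => o h; rewrite /= (flow_eq h).
Qed.

End solution_law.

Section product_marginals.
Context (R : realType) d1 d2 d3 (T1 : measurableType d1) (T2 : measurableType d2)
  (T3 : measurableType d3).

Lemma product_image (pi : probability T1 R) (nu : probability T2 R) (Q : probability T3 R)
    (f : T1 -> T2) (D : set (T2 * T3)) : measurable_fun setT f ->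
  (forall A, measurable A -> pi (f @^-1` A) = nu A) -> measurable D ->
  (pi \x Q)%E ((fun q => (f q.1, q.2)) @^-1` D) = (nu \x Q)%E D.
Proof.
move=> mf fnu mD.
have mg : measurable_fun setT (fun q : T1 * T3 => (f q.1, q.2)).
  apply: measurable_fun_pair; last exact: measurable_snd.
  exact: (measurableT_comp mf measurable_fst).
apply/esym; apply: (product_measure_unique (m' := image_law (pi \x Q)%E mg)) => // A B mA mB.
rewrite /= /image_law/pushforward.
rewrite (_ : _ @^-1` _ = (f @^-1` A) `*` B); last by apply/seteqP; split => -[].
transitivity (pi (f @^-1` A) * Q B)%E; last by rewrite fnu.
by apply: product_measure1E => //; rewrite -[X in measurable X]setTI; exact: mf.
Qed.

End product_marginals.

(** * Synchronous coupling *)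

Section transport_cost.
Context (R : realType) (d : nat).
Notation V := 'rV[R]_d.

Definition cost (p : R) (z : V * V) : \bar R := ((enorm (z.1 - z.2)) `^ p)%:E.

Lemma cost_ge0 p z : (0 <= cost p z)%E.
Proof. by rewrite lee_fin powR_ge0. Qed.

Lemma measurable_cost p : measurable_fun setT (cost p).
Proof.
apply/measurable_EFinP; apply: (measurableT_comp (measurable_powR p)).
apply: measurable_fun_enorm; apply: measurable_vectorB.
  exact: measurable_fst.
exact: measurable_snd.
Qed.

End transport_cost.

Section synchronous_coupling.
Context (R : realType) (d : nat).
Notation V := 'rV[R]_d.
Context dW (W : measurableType dW) (Q : probability W R).
Variables (F : V * W -> V) (G : set (V * W)) (c : R).
Hypothesis mF : measurable_fun setT F.
Hypothesis mG : measurable G.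
Hypothesis c0 : 0 < c.
Hypothesis contr : forall x y w, G (x, w) -> G (y, w) ->
  enorm (F (x, w) - F (y, w)) <= c * enorm (x - y).

Let pair_flow (q : (V * V) * W) : V * V := (F (q.1.1, q.2), F (q.1.2, q.2)).

Let mside1 : measurable_fun setT (fun q : (V * V) * W => (q.1.1, q.2)).
Proof.
apply: measurable_fun_pair; last exact: measurable_snd.
exact: (measurableT_comp measurable_fst measurable_fst).
Qed.

Let mside2 : measurable_fun setT (fun q : (V * V) * W => (q.1.2, q.2)).
Proof.
apply: measurable_fun_pair; last exact: measurable_snd.
exact: (measurableT_comp measurable_snd measurable_fst).
Qed.

Lemma measurable_pair_flow : measurable_fun setT pair_flow.
Proof. by apply: measurable_fun_pair; [exact: (measurableT_comp mF mside1)|exact: (measurableT_comp mF mside2)]. Qed.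

Variables (mu nu mu' nu' : probability V R).
Hypothesis muE : forall D, measurable D -> mu' D = (mu \x Q)%E (F @^-1` D).
Hypothesis nuE : forall D, measurable D -> nu' D = (nu \x Q)%E (F @^-1` D).
Hypothesis muG : (mu \x Q)%E G = 1%E.
Hypothesis nuG : (nu \x Q)%E G = 1%E.

(** Letting two flow lines be driven by the same noise turns a coupling of the
initial laws into a coupling of the laws at the later time. *)
Lemma synchronous_coupling (p : R) (pi : probability (V * V)%type R) :
  0 <= p -> coupling mu nu pi ->
  exists2 pi' : probability (V * V)%type R, coupling mu' nu' pi' &
    (\int[pi']_z cost p z <= (c `^ p)%:E * \int[pi]_z cost p z)%E.
Proof.
move=> p0 cpi; have mpf := measurable_pair_flow.
have cpi1 A : measurable A -> pi (fst @^-1` A) = mu A by move=> mA; have [] := cpi A mA.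
have cpi2 A : measurable A -> pi (snd @^-1` A) = nu A by move=> mA; have [] := cpi A mA.
have s1 D : measurable D -> (pi \x Q)%E ((fun q : (V * V) * W => (q.1.1, q.2)) @^-1` D) = (mu \x Q)%E D.
  by move=> mD; exact: (product_image Q measurable_fst cpi1 mD).
have s2 D : measurable D -> (pi \x Q)%E ((fun q : (V * V) * W => (q.1.2, q.2)) @^-1` D) = (nu \x Q)%E D.
  by move=> mD; exact: (product_image Q measurable_snd cpi2 mD).
have mFD D : measurable D -> measurable (F @^-1` D).
  by move=> mD; rewrite -[X in measurable X]setTI; exact: mF.
exists (image_law (pi \x Q)%E mpf).
  move=> D mD; split.
    by rewrite muE// -s1//; exact: mFD.
  by rewrite nuE// -s2//; exact: mFD.
have -> : (\int[image_law (pi \x Q) mpf]_z cost p z = \int[pi \x Q]_q cost p (pair_flow q))%E.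
  rewrite (ge0_integral_pushforward mpf (pi \x Q)%E measurableT)//.
    exact: measurable_cost.
  by move=> z _; exact: cost_ge0.
have -> : (\int[pi]_z cost p z = \int[pi \x Q]_q cost p q.1)%E.
  rewrite -[RHS](ge0_integral_pushforward measurable_fst (pi \x Q)%E measurableT
    (measurable_cost p)); last by move=> z _; exact: cost_ge0.
  apply: eq_measure_integral => A mA _ /=.
  rewrite /pushforward (_ : fst @^-1` A = A `*` setT); last first.
    by apply/seteqP; split => -[z w] //= [].
  transitivity (pi A * Q setT)%E; first by rewrite probability_setT mule1.
  by apply/esym; exact: product_measure1E.
have mc1 : measurable_fun setT (fun q : (V * V) * W => cost p q.1).
  exact: (measurableT_comp (measurable_cost p) measurable_fst).
rewrite -ge0_integralZl//; last 2 first.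
- by move=> q _; exact: cost_ge0.
- by rewrite lee_fin powR_ge0.
apply: ae_ge0_le_integral.
- exact: measurableT.
- by move=> q _; exact: cost_ge0.
- exact: (measurableT_comp (measurable_cost p) mpf).
- by move=> q _; rewrite mule_ge0 ?cost_ge0// lee_fin powR_ge0.
- exact: emeasurable_funM.
pose E1 := (fun q : (V * V) * W => (q.1.1, q.2)) @^-1` G.
pose E2 := (fun q : (V * V) * W => (q.1.2, q.2)) @^-1` G.
have mE1 : measurable E1 by rewrite -[X in measurable X]setTI; exact: mside1.
have mE2 : measurable E2 by rewrite -[X in measurable X]setTI; exact: mside2.
have full E : measurable E -> (pi \x Q)%E E = 1%E -> {ae (pi \x Q)%E, forall q, E q}.
  move=> mE E1_; exists (~` E); split => //; first exact: measurableC.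
  have := probability_setC (pi \x Q)%E mE; rewrite /= => ->.
  by rewrite E1_ subee.
apply: filterS2 (full _ mE1 (etrans (s1 _ mG) muG)) (full _ mE2 (etrans (s2 _ mG) nuG)).
move=> [[x y] w] /= g1 g2 _; rewrite /cost/= -EFinM lee_fin -powRM ?enorm_ge0 ?(ltW c0)//.
by apply: ge0_ler_powR => //; rewrite ?nnegrE ?mulr_ge0 ?enorm_ge0 ?(ltW c0)//; exact: contr.
Qed.

Lemma wasserstein_contraction (p : R) : 0 < p ->
  (wasserstein p mu' nu' <= c%:E * wasserstein p mu nu)%E.
Proof.
move=> p0; rewrite /wasserstein.
set S' := [set _ | _]; set S := [set _ | _].
have S_ge0 : (0 <= ereal_inf S)%E.
  apply: le_ereal_inf_tmp => _ [pi [_ ->]]; apply: integral_ge0 => z _; exact: cost_ge0.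
have S'_ge0 : (0 <= ereal_inf S')%E.
  apply: le_ereal_inf_tmp => _ [pi [_ ->]]; apply: integral_ge0 => z _; exact: cost_ge0.
have cp0 : 0 < c `^ p by rewrite powR_gt0.
have H : (ereal_inf S' <= (c `^ p)%:E * ereal_inf S)%E.
  rewrite -lee_pdivrMl//; apply: le_ereal_inf_tmp => _ [pi [cpi ->]].
  have [pi' cpi' le'] := synchronous_coupling (ltW p0) cpi.
  rewrite lee_pdivrMl//; apply: le_trans le'.
  by apply: ereal_inf_lbound; exists pi'.
have pV0 : 0 <= p^-1 by rewrite invr_ge0 ltW.
have cE : (c%:E = ((c `^ p)%:E `^ p^-1)%E :> \bar R).
  by rewrite poweR_EFin -powRrM mulfV ?gt_eqF// powRr1// ltW.
rewrite cE -poweRM//; last by rewrite lee_fin powR_ge0.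
by apply: gt0_ler_poweR => //; rewrite in_itv/= leey andbT// mule_ge0// lee_fin ltW.
Qed.

End synchronous_coupling.

(** * Tails of Gaussian increments *)

Section gaussian_tail.
Context (R : realType).
Notation mu := (@lebesgue_measure R).

Lemma expRN_le (u : R) : 0 < u -> expR (- u) <= 4 / u ^+ 2.
Proof.
move=> u0; have h : u / 2 <= expR (u / 2) by have := expR_ge1Dx (u / 2); lra.
have h2 : u ^+ 2 / 4 <= expR u.
  have -> : u = u / 2 + u / 2 by lra.
  rewrite expRD -expr2; apply: le_trans (_ : (u / 2) ^+ 2 <= _).
    rewrite le_eqVlt; apply/orP; left; apply/eqP; by field.
  by rewrite ler_pXn2r ?nnegrE ?expR_ge0// divr_ge0// ltW.
rewrite expRN -[leRHS]invrK lef_pV2 ?posrE ?expR_gt0 ?invr_gt0 ?divr_gt0 ?exprn_gt0//.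
by rewrite invf_div.
Qed.

(** Doubling the variance absorbs the fourth power of the threshold: this
replaces a computation of the fourth moment. *)
Lemma normal_pdf_tail (s a x : R) : 0 < s -> 0 < a -> a < `|x| ->
  normal_pdf 0 (Num.sqrt s) x <= 128 * s ^+ 2 / a ^+ 4 * normal_pdf 0 (Num.sqrt (2 * s)) x.
Proof.
move=> s0 a0 ax; have s20 : 0 < 2 * s by rewrite mulr_gt0.
rewrite !normal_pdfE ?gt_eqF ?sqrtr_gt0//.
rewrite /normal_fun /normal_peak subr0 !sqr_sqrtr ?(ltW s0) ?(ltW s20)//.
pose u := x ^+ 2 / (4 * s).
have x20 : 0 < x ^+ 2 by rewrite -(real_normK (num_real x)) exprn_gt0// (lt_trans a0).
have u0 : 0 < u by rewrite divr_gt0// mulr_gt0.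
have -> : - x ^+ 2 / (s *+ 2) = - u + - u by rewrite /u; field; rewrite gt_eqF.
have -> : - x ^+ 2 / ((2 * s) *+ 2) = - u by rewrite /u; field; rewrite gt_eqF.
rewrite expRD.
have eu : expR (- u) <= 64 * s ^+ 2 / a ^+ 4.
  apply: le_trans (expRN_le u0) _.
  have -> : 4 / u ^+ 2 = 64 * s ^+ 2 / (x ^+ 2) ^+ 2.
    have x0 : x != 0 by rewrite -sqrf_eq0 gt_eqF.
    by rewrite /u; field; rewrite ?x0 ?(gt_eqF s0).
  rewrite ler_wpM2l ?mulr_ge0 ?(ltW s0)// lef_pV2 ?posrE ?(exprn_gt0 _ x20) ?(exprn_gt0 _ a0)//.
  by rewrite -(real_normK (num_real x)) -exprM ler_pXn2r ?nnegrE ?(ltW a0)// ltW.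
have pk : (Num.sqrt (s * pi *+ 2))^-1 <= 2 * (Num.sqrt (2 * s * pi *+ 2))^-1.
  have sp : 0 < s * pi *+ 2 by rewrite mulrn_wgt0// mulr_gt0 ?pi_gt0.
  have sp2 : 0 < 2 * s * pi *+ 2 by rewrite mulrn_wgt0// !mulr_gt0 ?pi_gt0.
  have p0 : 0 < Num.sqrt (s * pi *+ 2) by rewrite sqrtr_gt0.
  have q0 : 0 < Num.sqrt (2 * s * pi *+ 2) by rewrite sqrtr_gt0.
  have q2p : Num.sqrt (2 * s * pi *+ 2) <= 2 * Num.sqrt (s * pi *+ 2).
    rewrite -(ler_pXn2r (n := 2)) ?nnegrE ?mulr_ge0 ?sqrtr_ge0//.
    rewrite exprMn !sqr_sqrtr ?(ltW sp) ?(ltW sp2)//.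
    by move: sp; rewrite -!mulrA; move: (s * pi) => z; lra.
  move: p0 q0 q2p; set p := Num.sqrt (s * pi *+ 2); set q := Num.sqrt (2 * s * pi *+ 2).
  move=> p0 q0 q2p.
  have -> : 2 * q^-1 = (q / 2)^-1 by field; rewrite gt_eqF.
  by rewrite lef_pV2 ?posrE ?divr_gt0// ler_pdivrMr// mulrC.
have E (q e : R) : 128 * s ^+ 2 / a ^+ 4 * (q * e) = (2 * q) * (e * (64 * s ^+ 2 / a ^+ 4)).
  by field; rewrite gt_eqF.
rewrite E.
apply: ler_pM; rewrite ?invr_ge0 ?sqrtr_ge0 ?mulr_ge0 ?expR_ge0//.
by rewrite ler_wpM2l ?expR_ge0.
Qed.

Lemma normal_tail (s a : R) : 0 < s -> 0 < a ->
  (normal_prob 0 (Num.sqrt s) [set x : R | (a < `|x|)%R] <= (128 * s ^+ 2 / a ^+ 4)%:E)%E.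
Proof.
move=> s0 a0; have s20 : 0 < 2 * s by rewrite mulr_gt0.
have mT : measurable [set x : R | a < `|x|].
  by apply: measurable_abs_gt; exact: measurable_id.
have K0 : 0 <= 128 * s ^+ 2 / a ^+ 4.
  by rewrite divr_ge0 ?mulr_ge0 ?exprn_ge0 ?(ltW a0) ?(ltW s0).
rewrite /normal_prob.
set T := [set x : R | a < `|x|] in mT *.
have mpdf r : measurable_fun T (fun x => (normal_pdf 0 r x)%:E).
  by apply/measurable_EFinP; apply: measurable_funTS; exact: measurable_normal_pdf.
apply: (@le_trans _ _ (\int[mu]_(x in T)
    ((128 * s ^+ 2 / a ^+ 4)%:E * (normal_pdf 0 (Num.sqrt (2 * s)) x)%:E))%E).
  apply: ge0_le_integral.
  - exact: mT.
  - by move=> x _; rewrite lee_fin normal_pdf_ge0.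
  - exact: mpdf.
  - by apply: emeasurable_funM; [exact: measurable_cst|exact: mpdf].
  - by move=> x ax; rewrite -EFinM lee_fin; exact: normal_pdf_tail.
have pdf0 r x : (0 <= (normal_pdf 0 r x)%:E :> \bar R)%E by rewrite lee_fin normal_pdf_ge0.
rewrite (ge0_integralZl mu mT (mpdf _) (fun x _ => pdf0 _ x)) ?lee_fin//.
rewrite -[X in (_ <= X)%E]mule1 lee_wpmul2l ?lee_fin//.
rewrite -(@integral_normal_pdf R 0 (Num.sqrt (2 * s))) ?gt_eqF ?sqrtr_gt0//.
apply: ge0_subset_integral => //.
by apply/measurable_EFinP; exact: measurable_normal_pdf.
Qed.

End gaussian_tail.

(** * Brownian motion is small on short intervals *)

Section chaining.
Context (R : realType) (d : nat).
Notation V := 'rV[R]_d.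
Notation W := (path_space (nat * nat)%type V).

(** The ratio [9/10] satisfies [2 (9/10)^4 > 1], which makes the fourth-moment
bounds summable over the [2 ^ N] increments of each level [N]. The equality ties
consecutive levels together, as for the values of one path. *)
Definition quiet (a : R) : set W := [set w | forall N k : nat,
  w (N.+1, k.*2) = w (N, k) /\
  ((k < 2 ^ N)%N -> forall i, `|(w (N, k.+1) - w (N, k) : V) 0 i| <= a * (9 / 10) ^+ N)].

(** The even times of level [N.+1] are the times of level [N], so each level
adds one increment; the budgets sum to a geometric series. *)
Lemma quiet_coord (a : R) (w : W) : 0 <= a -> quiet a w ->
  forall N k i, (k <= 2 ^ N)%N -> `|(w (N, k) - w (N, 0%N) : V) 0 i| <= 10 * a.
Proof.
move=> a0 qw N k i kN.
suff : `|(w (N, k) - w (N, 0%N) : V) 0 i| <= 10 * a * (1 - (9 / 10) ^+ N.+1).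
  move=> /le_trans; apply; rewrite -[leRHS]mulr1; apply: ler_wpM2l.
    by rewrite mulr_ge0.
  by rewrite gerBl exprn_ge0.
elim: N k kN => [|N ih] k kN.
  have [-> |k1] : k = 0%N \/ k = 1%N by case: k kN => [|[|]]; [left|right|].
    by rewrite subrr mxE normr0 mulr_ge0 ?mulr_ge0// subr_ge0 expr1; lra.
  rewrite k1; have s1 := (qw 0%N 0%N).2 isT i; rewrite expr0 mulr1 in s1.
  by apply: le_trans s1 _; rewrite expr1; lra.
have w0 : w (N.+1, 0%N) = w (N, 0%N) by have [] := qw N 0%N; rewrite double0.
have k2N : (k./2 <= 2 ^ N)%N by rewrite -(doubleK (2 ^ N)%N) half_leq// -mul2n -expnS.
have e2 : w (N.+1, k./2.*2) = w (N, k./2) by have [] := qw N k./2.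
have q0 : 0 <= a * (9 / 10) ^+ N.+1 by rewrite mulr_ge0 ?exprn_ge0.
have budget : 10 * a * (1 - (9 / 10) ^+ N.+2) =
    10 * a * (1 - (9 / 10) ^+ N.+1) + a * (9 / 10) ^+ N.+1 by rewrite (exprS _ N.+1); field.
rewrite budget w0; have [odd_k|even_k] := boolP (odd k).
  have ek : k = (k./2.*2).+1 by rewrite -[LHS]odd_double_half odd_k.
  have k2N' : (k./2.*2 < 2 ^ N.+1)%N by rewrite -ek in kN *.
  have s1 := (qw N.+1 k./2.*2).2 k2N' i; rewrite -ek e2 in s1.
  have -> : (w (N.+1, k) - w (N, 0%N) : V) 0 i =
      (w (N, k./2) - w (N, 0%N) : V) 0 i + (w (N.+1, k) - w (N, k./2) : V) 0 i.
    by rewrite !mxE; ring.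
  by rewrite (le_trans (ler_normD _ _))// lerD// ih.
have ek : k = k./2.*2 by rewrite -[LHS]odd_double_half (negPf even_k).
by rewrite {1}ek e2 (le_trans (ih _ k2N))// lerDl.
Qed.

Lemma quiet_noise (a : R) (sigma : 'M[R]_d) (w : W) : 0 <= a -> quiet a w ->
  forall N k, (k <= 2 ^ N)%N -> enorm (noise sigma w (N, k) - noise sigma w (N, 0%N))
    <= (\sum_i enorm (row i sigma^T)) * (d%:R * (10 * a)).
Proof.
move=> a0 qw N k kN; rewrite /noise -mulmxBl (le_trans (enorm_mulmx _ _))//.
rewrite ler_wpM2l//; first by apply: sumr_ge0 => i _; exact: enorm_ge0.
by apply: enorm_le_bound => i; exact: quiet_coord.
Qed.

Lemma measurable_quiet (a : R) : measurable (quiet a).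
Proof.
have mw i : measurable_fun setT (fun w : W => w i) by exact: measurable_path_coord.
pose S1 N k : set W := [set w | enorm (w (N.+1, k.*2) - w (N, k)) <= 0].
pose S2 N k i : set W := [set w | `|(w (N, k.+1) - w (N, k) : V) 0 i| <= a * (9 / 10) ^+ N].
have -> : quiet a = \bigcap_(N in [set: nat]) \bigcap_(k in [set: nat])
   (S1 N k `&` (if (k < 2 ^ N)%N then \bigcap_(i in [set: 'I_d]) S2 N k i else setT)).
  apply/seteqP; split => w /= h.
    move=> N _ k _; have [h1 h2] := h N k; split.
      by rewrite /S1/= h1 subrr enorm0.
    by case: ifP => // kN i _; exact: h2.
  move=> N k; have [h1 h2] := h N Logic.I k Logic.I; split.
    apply/eqP; rewrite -subr_eq0; apply/eqP/enorm_eq0/eqP.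
    by rewrite eq_le enorm_ge0 andbT.
  by move=> kN i; move: h2; rewrite kN => h2; exact: h2.
apply: bigcap_measurableType => N _; apply: bigcap_measurableType => k _.
apply: measurableI.
  by apply: measurable_sublevel; apply: measurable_fun_enorm; exact: measurable_vectorB.
case: ifP => // _; apply: fin_bigcap_measurable => // i _; apply: measurable_sublevel.
apply: (measurableT_comp (@normr_measurable R setT)).
by apply: measurable_fun_coord; exact: measurable_vectorB.
Qed.

Lemma finite_union_bound dO (O : measurableType dO) (P : probability O R) (I : eqType)
    (s : seq I) (A : I -> set O) (c : R) :
  (forall i, measurable (A i)) -> (forall i, i \in s -> (P (A i) <= c%:E)%E) ->
  (P [set o | exists2 i, i \in s & A i o] <= ((size s)%:R * c)%:E)%E.
Proof.
move=> mA; elim: s => [|i s ih] hc.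
  rewrite mul0r (_ : [set _ | _] = set0) ?measure0//.
  by apply/seteqP; split => o //= [].
have mU : forall l : seq I, measurable [set o | exists2 i, i \in l & A i o].
  elim=> [|j l ihl].
    rewrite (_ : [set _ | _] = set0) ?measure0//.
    by apply/seteqP; split => o //= [].
  rewrite (_ : [set _ | _] = A j `|` [set o | exists2 i, i \in l & A i o]).
    exact: measurableU.
  apply/seteqP; split => o /=.
    by move=> [m]; rewrite inE => /orP[/eqP ->|ml Am]; [left|right; exists m].
  by move=> [h|[m ml Am]]; [exists j => //; rewrite mem_head|exists m => //; rewrite inE ml orbT].
rewrite (_ : [set _ | _] = A i `|` [set o | exists2 i, i \in s & A i o]).
  apply: (@le_trans _ _ (P (A i) + P [set o | exists2 i, i \in s & A i o])%E).
    exact: measureU2.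
  rewrite /= -natr1 addrC mulrDl mul1r EFinD leeD ?hc ?mem_head//.
  by apply: ih => j js; apply: hc; rewrite inE js orbT.
apply/seteqP; split => o /=.
  by move=> [m]; rewrite inE => /orP[/eqP ->|ml Am]; [left|right; exists m].
by move=> [h|[m ml Am]]; [exists i => //; rewrite mem_head|exists m => //; rewrite inE ml orbT].
Qed.

Lemma countable_union_bound dO (O : measurableType dO) (P : probability O R)
    (A : nat -> set O) (K : R) : 0 <= K -> (forall n, measurable (A n)) ->
  (forall n, (P (A n) <= (K * (4 / 5) ^+ n)%:E)%E) ->
  (P (\bigcup_n A n) <= (5 * K)%:E)%E.
Proof.
move=> K0 mA hA.
apply: (le_trans (generalized_Boole_inequality P mA (bigcupT_measurable _ mA))).
apply: lime_le; first by apply: is_cvg_nneseries => n _ _; exact: measure_ge0.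
apply: nearW => n.
apply: (@le_trans _ _ (5 * K * (1 - (4 / 5) ^+ n))%:E); last first.
  rewrite lee_fin -[leRHS]mulr1; apply: ler_wpM2l; first by rewrite mulr_ge0.
  by rewrite gerBl exprn_ge0.
elim: n => [|n ih]; first by rewrite big_nil expr0 subrr mulr0.
rewrite big_nat_recr//=; apply: le_trans (leeD ih (hA n)) _.
rewrite -EFinD lee_fin le_eqVlt; apply/orP; left; apply/eqP; rewrite exprS.
by field.
Qed.

Context dO (O : measurableType dO) (P : probability O R) (B : R -> O -> V).
Hypothesis bm : standard_brownian_motion P B.
Variables (t : R) (t0 : 0 < t).

Lemma increment_tail (N k : nat) (i : 'I_d) (c : R) : 0 < c ->
  (P [set o | (c < `|(B (dyadic t (N, k.+1)) o - B (dyadic t (N, k)) o) 0%R i|)%R]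
    <= (128 * (t / 2 ^+ N) ^+ 2 / c ^+ 4)%:E)%E.
Proof.
move=> c0; pose h := t / 2 ^+ N; have h0 : 0 < h by rewrite divr_gt0 ?exprn_gt0.
have dh : dyadic t (N, k.+1) - dyadic t (N, k) = h.
  by rewrite /dyadic/= -(natr1 k) mulrDl mul1r addrC addKr.
have lt_d : dyadic t (N, k) < dyadic t (N, k.+1) by rewrite -subr_gt0 dh.
have [_ g] := bm_gaussian_increments bm (dyadic_ge0 (N, k) (ltW t0)) lt_d.
have mT : measurable [set x : R | c < `|x|].
  by apply: measurable_abs_gt; exact: measurable_id.
by have := g i _ mT; rewrite dh /= => ->; exact: normal_tail.
Qed.

(** The union bound over all dyadic increments: the failure probability is of
second order in [t]. *)
Lemma quiet_probability (a : R) : 0 < a ->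
  ((1 - 640 * d%:R * t ^+ 2 / a ^+ 4)%:E <= wiener_law bm t0 (quiet a))%E.
Proof.
move=> a0; pose Z := dyadic_path B t.
pose A N (j : 'I_(2 ^ N) * 'I_d) : set O := [set o |
   a * (9 / 10) ^+ N < `|(B (dyadic t (N, (j.1 : nat).+1)) o - B (dyadic t (N, j.1 : nat)) o) 0 j.2|].
pose Bad N : set O := [set o | exists2 j, j \in enum ({: 'I_(2 ^ N) * 'I_d}) & A N j o].
have mZ : measurable_fun setT Z by exact: measurable_dyadic_path (ltW t0) bm.
have mA N j : measurable (A N j).
  apply: measurable_abs_gt; apply: measurable_fun_coord; apply: measurable_vectorB;
    apply: (bm_measurable bm); exact: dyadic_ge0 (ltW t0).
pose K : R := 128 * d%:R * t ^+ 2 / a ^+ 4.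
have K0 : 0 <= K by rewrite divr_ge0 ?mulr_ge0 ?exprn_ge0 ?(ltW a0) ?(ltW t0).
have mBad N : measurable (Bad N).
  rewrite (_ : Bad N = \bigcup_(j in [set` enum {: 'I_(2 ^ N) * 'I_d}]) A N j).
    by apply: fin_bigcup_measurable => //; exact: finite_seq.
  by apply/seteqP; split => o /=; [case=> j js h; exists j|case=> j js h; exists j].
have hBad N : (P (Bad N) <= (K * (4 / 5) ^+ N)%:E)%E.
  have q0 : 0 < a * (9 / 10) ^+ N by rewrite mulr_gt0 ?exprn_gt0.
  apply: le_trans (finite_union_bound (mA N) (fun j _ => increment_tail N j.1 j.2 q0)) _.
  rewrite -cardE card_prod !card_ord lee_fin natrM natrX.
  have p0 : (2 ^+ N : R) != 0 by rewrite expf_neq0// pnatr_eq0.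
  have n0 : ((9 / 10) ^+ N : R) != 0 by rewrite expf_neq0//; lra.
  rewrite [leLHS](_ : _ = K * ((2 ^+ N)^-1 * ((9 / 10) ^+ N ^+ 4)^-1)); last first.
    rewrite /K; move: p0 n0; move: (2 ^+ N) ((9 / 10) ^+ N) => p n p0 n0.
    by field; rewrite p0 n0 gt_eqF.
  rewrite ler_wpM2l// -exprM mulnC exprM -exprVn -exprVn -exprMn.
  have base : 2^-1 * ((9 / 10) ^+ 4)^-1 <= 4 / 5 :> R.
    have q2 : 4 / 5 <= (9 / 10) ^+ 2 :> R by rewrite expr2; lra.
    have q4 : 5 / 8 <= (9 / 10) ^+ 4 :> R.
      rewrite (exprM _ 2 2); apply: (@le_trans _ _ ((4 / 5) ^+ 2)).
        by rewrite expr2; lra.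
      by rewrite ler_pXn2r ?nnegrE//; lra.
    have -> : 4 / 5 = 2^-1 * (5 / 8)^-1 :> R by field.
    rewrite ler_pM2l ?invr_gt0// lef_pV2 ?posrE ?exprn_gt0//; lra.
  by apply: lerXn2r; rewrite ?nnegrE ?mulr_ge0 ?invr_ge0 ?exprn_ge0.
have sub : Z @^-1` (~` quiet a) `<=` \bigcup_N Bad N.
  move=> o /= nq; apply: contrapT => nb; apply: nq => N k; split.
    by rewrite /Z/dyadic_path; congr (B _ _); rewrite /dyadic/= exprS -muln2 natrM; field;
      rewrite expf_neq0// pnatr_eq0.
  move=> kN i; rewrite leNgt; apply/negP => lt_i; apply: nb.
  by exists N => //; exists (Ordinal kN, i) => //; rewrite mem_enum.
have mq := measurable_quiet a.
have mqC : measurable (Z @^-1` (~` quiet a)).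
  by rewrite -[X in measurable X]setTI; apply: mZ => //; exact: measurableC.
have le5 : (wiener_law bm t0 (~` quiet a) <= (5 * K)%:E)%E.
  apply: le_trans (countable_union_bound K0 mBad hBad).
  have -> : wiener_law bm t0 (~` quiet a) = P (Z @^-1` (~` quiet a)) by [].
  by apply: le_measure; rewrite ?inE//; exact: bigcupT_measurable.
have := probability_setC (wiener_law bm t0) (measurableC mq); rewrite setCK => ->.
rewrite EFinB; apply: leeB => //.
by apply: le_trans le5 _; rewrite lee_fin /K; lra.
Qed.

End chaining.

(** * A dual lower bound for the Wasserstein distance *)

Section kantorovich.
Context (R : realType) (d : nat).
Notation V := 'rV[R]_d.

(** Young's inequality in disguise. *)
Lemma powR_tangent (p a c : R) : 1 <= p -> 0 <= a -> 0 < c ->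
  p * c `^ (p - 1) * a <= a `^ p + (p - 1) * c `^ p.
Proof.
move=> p1 a0 c0; have p0 : 0 < p by exact: lt_le_trans p1.
have [->|pn1] := eqVneq p 1.
  by rewrite subrr powRr0 mul1r mul1r powRr1// mul0r addr0.
have p10 : 0 < p - 1 by rewrite subr_gt0 lt_neqAle eq_sym pn1.
pose q := p / (p - 1); have q0 : 0 < q by rewrite divr_gt0.
have pq : p^-1 + q^-1 = 1 by rewrite /q; field; rewrite !gt_eqF.
have := conjugate_powR a0 (powR_ge0 c (p - 1)) p0 q0 pq.
have -> : (c `^ (p - 1)) `^ q = c `^ p.
  by rewrite -powRrM; congr (_ `^ _); rewrite /q; field; rewrite gt_eqF.
move=> /(ler_wpM2l (ltW p0)).
have -> : p * (a `^ p / p + c `^ p / q) = a `^ p + (p - 1) * c `^ p.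
  by rewrite /q; field; rewrite !gt_eqF.
by apply: le_trans; rewrite mulrAC mulrA.
Qed.

Lemma bounded_integral_fine (mu : probability V R) (f : V -> R) (M : R) :
  measurable_fun setT f -> (forall z, 0 <= f z <= M) ->
  exists I : R, (\int[mu]_z (f z)%:E = I%:E)%E.
Proof.
move=> mf f0M.
have h : (\int[mu]_z (f z)%:E \is a fin_num)%E.
  rewrite ge0_fin_numE; last first.
    by apply: integral_ge0 => z _; rewrite lee_fin; have /andP[] := f0M z.
  apply: (@le_lt_trans _ _ (\int[mu]_z (cst M%:E z))%E).
    apply: ge0_le_integral => //.
    - by move=> z _; rewrite lee_fin; have /andP[] := f0M z.
    - exact/measurable_EFinP.
    - by move=> z _; rewrite lee_fin; have /andP[] := f0M z.
  by rewrite integral_cst//= probability_setT mule1 ltry.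
by exists (fine (\int[mu]_z (f z)%:E)%E); rewrite fineK.
Qed.

(** The easy half of Kantorovich duality, for a general exponent: [x `^ p] lies
above its tangent line at [c], along which the test function is integrated. All
terms are kept nonnegative, so an infinite cost is harmless. *)
Lemma kantorovich_lower (p c M : R) (f : V -> R) (mu nu : probability V R) :
  1 <= p -> 0 < c -> measurable_fun setT f -> (forall z, 0 <= f z <= M) ->
  (forall z1 z2, f z2 - f z1 <= enorm (z1 - z2)) ->
  (\int[mu]_z (f z)%:E + c%:E <= \int[nu]_z (f z)%:E)%E ->
  (c%:E <= wasserstein p mu nu)%E.
Proof.
move=> p1 c0 mf f0M lipf; have p0 : 0 < p by exact: lt_le_trans p1.
have [I1 I1E] := bounded_integral_fine mu mf f0M.
have [I2 I2E] := bounded_integral_fine nu mf f0M.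
rewrite I1E I2E -EFinD lee_fin => I12.
have fz0 z : 0 <= f z by have /andP[] := f0M z.
have mEf : measurable_fun setT (fun z => (f z)%:E) by exact/measurable_EFinP.
pose K := p * c `^ (p - 1); pose B := (p - 1) * c `^ p.
have K0 : 0 <= K by rewrite mulr_ge0 ?powR_ge0// ltW.
have B0 : 0 <= B by rewrite mulr_ge0 ?powR_ge0// subr_ge0.
have KB : K * c - B = c `^ p.
  have -> : K * c = p * c `^ p.
    by rewrite /K -mulrA -{2}(powRr1 (ltW c0)) -powRD ?subrK// (gt_eqF c0) implybT.
  by rewrite /B mulrBl mul1r opprB addrC subrK.
have key (pi : probability (V * V)%type R) : coupling mu nu pi ->
    ((c `^ p)%:E <= \int[pi]_z cost p z)%E.
  move=> cpi.
  have m1 : measurable_fun setT (fun z : V * V => (f z.1)%:E).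
    exact: (measurableT_comp mEf measurable_fst).
  have m2 : measurable_fun setT (fun z : V * V => (f z.2)%:E).
    exact: (measurableT_comp mEf measurable_snd).
  have i1 : (\int[pi]_z (f z.1)%:E = I1%:E)%E.
    rewrite -I1E -(ge0_integral_pushforward measurable_fst pi measurableT mEf); last first.
      by move=> z _; rewrite lee_fin.
    by apply: eq_measure_integral => A mA _; have [] := cpi A mA.
  have i2 : (\int[pi]_z (f z.2)%:E = I2%:E)%E.
    rewrite -I2E -(ge0_integral_pushforward measurable_snd pi measurableT mEf); last first.
      by move=> z _; rewrite lee_fin.
    by apply: eq_measure_integral => A mA _; have [] := cpi A mA.
  have H : (\int[pi]_z (K%:E * (f z.2)%:E) <=
      \int[pi]_z (cost p z + (K%:E * (f z.1)%:E + B%:E)))%E.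
    apply: ge0_le_integral => //.
    - by move=> z _; rewrite mule_ge0 ?lee_fin //.
    - exact: emeasurable_funM.
    - apply: emeasurable_funD; first exact: measurable_cost.
      by apply: emeasurable_funD => //; exact: emeasurable_funM.
    move=> z _; rewrite /cost -!EFinM -!EFinD lee_fin.
    have := powR_tangent p1 (enorm_ge0 (z.1 - z.2)) c0; rewrite -/K -/B.
    have := ler_wpM2l K0 (lipf z.1 z.2); rewrite mulrBr; lra.
  move: H; rewrite ge0_integralZl ?lee_fin//; last by move=> z _; rewrite lee_fin.
  rewrite (_ : (\int[pi]_z (cost p z + (K%:E * (f z.1)%:E + B%:E)) = \int[pi]_z cost p z +
    (\int[pi]_z (K%:E * (f z.1)%:E) + \int[pi]_z (cst B%:E z)))%E); last first.
    rewrite -ge0_integralD.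
    - apply: ge0_integralD.
      + exact: measurableT.
      + by move=> z _; exact: cost_ge0.
      + exact: measurable_cost.
      + by move=> z _; rewrite adde_ge0 ?mule_ge0 ?lee_fin //.
      + by apply: emeasurable_funD => //; exact: emeasurable_funM.
    - exact: measurableT.
    - by move=> z _; rewrite mule_ge0 ?lee_fin //.
    - exact: emeasurable_funM.
    - by move=> z _; rewrite lee_fin.
    - exact: measurable_cst.
  rewrite ge0_integralZl ?lee_fin//; last by move=> z _; rewrite lee_fin.
  rewrite i1 i2 integral_cst//= probability_setT mule1 -!EFinM -EFinD.
  case: (\int[pi]_z cost p z)%E => [C|_|]; [|by rewrite leey|by []].
  rewrite -EFinD !lee_fin -KB.
  have := ler_wpM2l K0 I12; rewrite mulrDr; lra.
have cE : (c%:E = ((c `^ p)%:E `^ p^-1)%E :> \bar R).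
  by rewrite poweR_EFin -powRrM mulfV ?gt_eqF// powRr1// ltW.
rewrite cE; apply: gt0_ler_poweR.
- by rewrite invr_ge0 ltW.
- by rewrite in_itv/= leey andbT lee_fin powR_ge0.
- rewrite in_itv/= leey andbT; apply: le_ereal_inf_tmp => _ [pi [_ ->]].
  by apply: integral_ge0 => z _; exact: cost_ge0.
by apply: le_ereal_inf_tmp => _ [pi [cpi ->]]; exact: key.
Qed.

(** Truncation makes the linear functional integrable against every law, so
that no moment of the solutions enters the argument. *)
Definition clipped_dot (v x z : V) : R := Num.max 0 (Num.min 2 (1 + dot v (z - x))).

Lemma clipped_dot_bounded v x z : 0 <= clipped_dot v x z <= 2.
Proof. by rewrite /clipped_dot le_max lexx ge_max ge_min lexx ler0n. Qed.

Lemma clipped_dot_near v x z : enorm v = 1 -> enorm (z - x) <= 1 ->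
  clipped_dot v x z = 1 + dot v (z - x).
Proof.
move=> v1 zx; have := normr_dot v (z - x); rewrite v1 mul1r ler_norml => /andP[h1 h2].
rewrite /clipped_dot min_r; last by lra.
by rewrite max_r//; lra.
Qed.

Lemma clipped_dot_lipschitz v x z1 z2 : enorm v = 1 ->
  clipped_dot v x z2 - clipped_dot v x z1 <= enorm (z1 - z2).
Proof.
move=> v1; have : dot v (z2 - x) - dot v (z1 - x) <= enorm (z1 - z2).
  rewrite -dotNr -dotDr opprB addrA subrK.
  by have := dot_le_enorm v (z2 - z1); rewrite v1 mul1r enorm_distC.
have := enorm_ge0 (z1 - z2); rewrite /clipped_dot.
move: (dot v (z2 - x)) (dot v (z1 - x)) (enorm _) => a b e e0 abe.
rewrite /Num.max /Num.min.
case: (ltP 2 (1 + a)) => ?; case: (ltP 2 (1 + b)) => ?.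
- by rewrite !ltr0n; lra.
- by rewrite ltr0n; case: ltP => ?; lra.
- by rewrite ltr0n; case: ltP => ?; lra.
- by case: ltP => ?; case: ltP => ?; lra.
Qed.

Lemma measurable_clipped_dot v x : measurable_fun setT (clipped_dot v x).
Proof.
apply: measurable_maxr; first exact: measurable_cst.
apply: measurable_minr; first exact: measurable_cst.
apply: measurable_funD; first exact: measurable_cst.
apply: measurable_sum => i; apply: measurable_funM; first exact: measurable_cst.
apply: measurable_fun_coord; apply: measurable_vectorB; last exact: measurable_cst.
exact: measurable_id.
Qed.

End kantorovich.

(** * Point masses *)

Section dirac_masses.
Context (R : realType) (d : nat).
Notation V := 'rV[R]_d.
Notation pdirac x := (@dirac _ V x R : probability V R).

Lemma dirac_product dW (W : measurableType dW) (Q : probability W R) (x : V)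
    (D : set (V * W)) : measurable D ->
  (pdirac x \x Q)%E D = Q [set w | D (x, w)].
Proof.
move=> mD; rewrite /product_measure1 integral_dirac//.
  rewrite diracE in_setT mul1e /=; congr (Q _).
  by apply/seteqP; split => w; rewrite /xsection/= inE.
exact: measurable_fun_xsection.
Qed.

Lemma dirac_section dW (W : measurableType dW) (Q : probability W R) (x : V)
    (F : V * W -> V) (G : set (V * W)) (mu : probability V R) :
  measurable_fun setT F -> measurable G ->
  (forall D, measurable D -> mu D = (pdirac x \x Q)%E (F @^-1` D)) ->
  (pdirac x \x Q)%E G = 1%E ->
  (forall D, measurable D -> mu D = Q ((fun w => F (x, w)) @^-1` D)) /\
  {ae Q, forall w, G (x, w)}.
Proof.
move=> mF mG muE full; split.
  move=> D mD; rewrite muE// dirac_product//.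
  by rewrite -[X in measurable X]setTI; exact: mF.
move: full; rewrite dirac_product// => full.
have mE : measurable [set w : W | G (x, w)].
  have mp : measurable_fun setT (fun w : W => (x, w)).
    by apply: measurable_fun_pair; [exact: measurable_cst|exact: measurable_id].
  by rewrite -[X in measurable X]setTI; exact: (mp _ _ mG).
exists (~` [set w : W | G (x, w)]); split => //; first exact: measurableC.
by rewrite probability_setC// full subee.
Qed.

Lemma dirac_finite_moment (p : R) (x : V) : finite_moment p (pdirac x).
Proof.
rewrite /finite_moment integral_dirac//.
  by rewrite diracE in_setT mul1e ltry.
apply/measurable_EFinP; apply: (measurableT_comp (measurable_powR p)).
apply: measurable_fun_enorm; exact: measurable_id.
Qed.

Lemma dirac_distinct (x y : V) : 0 < enorm (x - y) ->
  exists2 A : set V, measurable A & pdirac x A <> pdirac y A.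
Proof.
move=> xy; exists [set z : V | enorm (z - x) <= 0].
  apply: measurable_sublevel; apply: measurable_fun_enorm.
  by apply: measurable_vectorB; [exact: measurable_id|exact: measurable_cst].
have dE z A : pdirac z A = ((z \in A)%:R)%:E by exact: diracE.
rewrite !dE mem_set /= ?subrr ?enorm0// memNset /=.
  by move=> /eqP; rewrite eqe oner_eq0.
by apply/negP; rewrite -ltNge enorm_distC.
Qed.

Lemma wasserstein_ge0 (p : R) (mu nu : probability V R) : (0 <= wasserstein p mu nu)%E.
Proof. exact: poweR_ge0. Qed.

Lemma wasserstein_dirac (p : R) (x y : V) : 1 <= p ->
  (wasserstein p (pdirac x) (pdirac y) <= (enorm (x - y))%:E)%E.
Proof.
move=> p1; have p0 : 0 < p by exact: lt_le_trans p1.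
have -> : ((enorm (x - y))%:E = (((enorm (x - y)) `^ p)%:E `^ p^-1)%E :> \bar R).
  by rewrite poweR_EFin -powRrM mulfV ?gt_eqF// powRr1// enorm_ge0.
apply: gt0_ler_poweR.
- by rewrite invr_ge0 ltW.
- rewrite in_itv/= leey andbT; apply: le_ereal_inf_tmp => _ [pi [_ ->]].
  by apply: integral_ge0 => z _; exact: cost_ge0.
- by rewrite in_itv/= leey andbT lee_fin powR_ge0.
apply: ereal_inf_lbound.
exists (@dirac _ (V * V)%type (x, y) R : probability (V * V)%type R); split.
  by move=> A mA; split.
rewrite integral_dirac//; last exact: measurable_cost.
by rewrite diracE in_setT mul1e.
Qed.

End dirac_masses.

Section quotients.
Context (R : realType).

(** Quotients of distances may be [0 / 0] or have an infinite denominator; with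
the conventions for extended reals both evaluate to [0]. *)
Lemma ratio_le (w' w : \bar R) (c : R) : (0 <= w')%E -> (0 <= w)%E -> 0 < c ->
  (w' <= c%:E * w)%E -> (w' / w <= c%:E)%E.
Proof.
move=> w'0 w0 c0; case: w w0 => [r||] //; last by move=> _ _; rewrite invey mule0 lee_fin; exact: ltW.
rewrite lee_fin le_eqVlt => /orP[/eqP <-|r0].
  rewrite mule0 => w'le; have -> : w' = 0%E by apply: le_anti; rewrite w'le w'0.
  by rewrite mul0e lee_fin ltW.
rewrite inver gt_eqF// -EFinM => h.
apply: (@le_trans _ _ ((c * r)%:E * (r^-1)%:E)%E).
  by apply: lee_wpmul2r => //; rewrite lee_fin invr_ge0 ltW.
by rewrite -EFinM lee_fin mulfK// gt_eqF.
Qed.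

Lemma ratio_ge (w' w : \bar R) (c del : R) : 0 < c -> 0 < del -> (0 <= w)%E ->
  (c%:E <= w')%E -> (w <= del%:E)%E -> ((c / del)%:E <= w' / w)%E.
Proof.
move=> c0 del0; case: w => [r||] //.
rewrite !lee_fin le_eqVlt => /orP[/eqP <-|r0] cw' rdel.
  rewrite inve0 gt0_muley ?leey//; apply: lt_le_trans cw'; by rewrite lte_fin.
rewrite inver gt_eqF//.
apply: (@le_trans _ _ (c%:E * (r^-1)%:E)%E).
  by rewrite -EFinM lee_fin ler_wpM2l ?(ltW c0)// lef_pV2.
by apply: lee_wpmul2r => //; rewrite lee_fin invr_ge0 ltW.
Qed.

End quotients.

Section separation.
Context (R : realType) (d : nat).
Notation V := 'rV[R]_d.
Context dW (W : measurableType dW) (Q : probability W R).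

(** The inequality on [N] is integrated with weight at least [1 - k], the weaker
one off [N] with weight at most [k]. *)
Lemma mean_separation (X Y : W -> V) (mu nu : probability V R) (f : V -> R) (M m L k : R)
    (N : set W) :
  measurable_fun setT X -> measurable_fun setT Y ->
  (forall D, measurable D -> mu D = Q (X @^-1` D)) ->
  (forall D, measurable D -> nu D = Q (Y @^-1` D)) ->
  measurable_fun setT f -> (forall z, 0 <= f z <= M) ->
  0 <= m -> 0 <= L -> measurable N -> ((1 - k)%:E <= Q N)%E ->
  {ae Q, forall w, N w -> f (X w) + m <= f (Y w)} ->
  {ae Q, forall w, f (X w) <= f (Y w) + L} ->
  (\int[mu]_z (f z)%:E + (m - (m + L) * k)%:E <= \int[nu]_z (f z)%:E)%E.
Proof.
move=> mX mY muE nuE mf f0M m0 L0 mN QN good bad.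
have fz0 z : 0 <= f z by have /andP[] := f0M z.
have mEf : measurable_fun setT (fun z => (f z)%:E) by exact/measurable_EFinP.
have push (Z : W -> V) (rho : probability V R) : measurable_fun setT Z ->
    (forall D, measurable D -> rho D = Q (Z @^-1` D)) ->
    (\int[rho]_z (f z)%:E = \int[Q]_w (f (Z w))%:E)%E.
  move=> mZ rhoE.
  transitivity (\int[pushforward Q Z]_z (f z)%:E)%E.
    have -> : (\int[pushforward Q Z]_z (f z)%:E = \int[image_law Q mZ]_z (f z)%:E)%E by [].
    by apply: eq_measure_integral => A mA _; rewrite /= rhoE.
  rewrite (ge0_integral_pushforward mZ Q measurableT mEf)//.
  by move=> z _; rewrite lee_fin.
have [I1 I1E] := bounded_integral_fine mu mf f0M.
have [I2 I2E] := bounded_integral_fine nu mf f0M.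
have mfX : measurable_fun setT (fun w => (f (X w))%:E) by exact: (measurableT_comp mEf mX).
have mfY : measurable_fun setT (fun w => (f (Y w))%:E) by exact: (measurableT_comp mEf mY).
have mI (A : set W) : measurable A -> measurable_fun setT (fun w => (\1_A w)%:E : \bar R).
  by move=> mA; apply/measurable_EFinP; exact: measurable_indic.
have mNC := measurableC mN.
have IZ (Z : W -> V) (A : set W) (c : R) : measurable_fun setT (fun w => (f (Z w))%:E) ->
    measurable A -> 0 <= c ->
    (\int[Q]_w ((f (Z w))%:E + c%:E * (\1_A w)%:E) = \int[Q]_w (f (Z w))%:E + c%:E * Q A)%E.
  move=> mfZ mA c0; rewrite ge0_integralD.
  - rewrite ge0_integralZl//.
    + by rewrite integral_indic// setIT.
    + exact: mI.
  - exact: measurableT.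
  - by move=> w _; rewrite lee_fin.
  - exact: mfZ.
  - by move=> w _; rewrite -EFinM lee_fin mulr_ge0.
  - by apply: emeasurable_funM => //; exact: mI.
have H : (\int[Q]_w ((f (X w))%:E + m%:E * (\1_N w)%:E) <=
    \int[Q]_w ((f (Y w))%:E + L%:E * (\1_(~` N) w)%:E))%E.
  apply: ae_ge0_le_integral.
  - exact: measurableT.
  - by move=> w _; rewrite -EFinM -EFinD lee_fin addr_ge0// mulr_ge0.
  - by apply: emeasurable_funD => //; apply: emeasurable_funM => //; exact: mI.
  - by move=> w _; rewrite -EFinM -EFinD lee_fin addr_ge0// mulr_ge0.
  - by apply: emeasurable_funD => //; apply: emeasurable_funM => //; exact: mI.
  apply: filterS2 good bad => w gw bw _.
  rewrite -!EFinM -!EFinD lee_fin !indicE.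
  have [Nw|Nw] := pselect (N w).
    by rewrite mem_set// memNset ?mulr1 ?mulr0 ?addr0; [exact: gw|move=> /(_ Nw)].
  by rewrite memNset// mem_set// mulr0 addr0 mulr1.
move: H; rewrite !IZ// -(push _ _ mX muE) -(push _ _ mY nuE) I1E I2E.
rewrite probability_setC//.
have QNfin : Q N \is a fin_num by exact: fin_num_measure.
move: QN; rewrite -(fineK QNfin) lee_fin; move: (fine (Q N)) => n kn.
rewrite -EFinB -!EFinM -!EFinD !lee_fin => h.
have := ler_wpM2l (addr_ge0 m0 L0) kn; move: h; lra.
Qed.

End separation.

(** * Bounds on the contraction rate *)

Section contraction_rate_bounds.
Context (R : realType) (d : nat).
Notation V := 'rV[R]_d.
Notation W := (path_space (nat * nat)%type V).
Notation pdirac x := (@dirac _ V x R : probability V R).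
Variables (b : V -> V) (A : V -> 'M[R]_d) (C lam : R).
Hypothesis C0 : 0 <= C.
Hypothesis taylor : forall x u : V, enorm (b (x + u) - b x - u *m A x) <= C * enorm u ^+ 2.
Hypothesis lipA : forall x y u : V,
  enorm (u *m A x - u *m A y) <= C * enorm u * enorm (x - y).
Hypothesis cb : continuous b.
Hypothesis lamA : forall x v : V, dot v (v *m A x) <= - lam * enorm v ^+ 2.
Variables (sigma : 'M[R]_d) (Pt : R -> probability V R -> probability V R).
Hypothesis hPt : is_sde_semigroup b sigma Pt.
Variables (p : R) (p1 : 1 <= p).

Lemma flow_contraction (t : R) (x y : V) (w : W) : 0 < t ->
  converging b sigma t (x, w) -> converging b sigma t (y, w) ->
  enorm (flow b sigma t (x, w) - flow b sigma t (y, w)) <= expR (- lam * t) * enorm (x - y).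
Proof.
move=> t0 cx cy.
exact: (scheme_contraction C0 taylor lipA t0 lamA cx cy).
Qed.

Lemma semigroup_law (t : R) (t0 : 0 < t) d1 (O1 : measurableType d1) (P1 : probability O1 R)
    (B1 : R -> O1 -> V) (bm1 : standard_brownian_motion P1 B1) (nu : probability V R) :
  (forall D, measurable D ->
     Pt t nu D = (nu \x wiener_law bm1 t0)%E (flow b sigma t @^-1` D)) /\
  (nu \x wiener_law bm1 t0)%E (converging b sigma t) = 1%E.
Proof.
have [d2 [T2 [P2 [B2 [X2 [sol2 lawE]]]]]] := hPt nu; split.
  move=> D mD; rewrite lawE ?ltW//.
  exact: (solution_law C0 taylor lipA cb t0 bm1 sol2 mD).
exact: (converging_full C0 taylor lipA cb t0 bm1 sol2).
Qed.

Lemma contraction_rate_upper (t : R) : 0 < t ->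
  (contraction_rate Pt p t <= (expR (- lam * t))%:E)%E.
Proof.
move=> t0; have p0 : 0 < p by exact: lt_le_trans p1.
have [d1 [T1 [P1 [B1 [X1 [sol1 _]]]]]] := hPt (pdirac 0).
have bm1 := sol_brownian sol1.
apply: ge_ereal_sup => _ [nu [mu [_ _ _ ->]]].
have [nuE nuG] := semigroup_law t0 bm1 nu.
have [muE muG] := semigroup_law t0 bm1 mu.
apply: ratio_le; rewrite ?wasserstein_ge0 ?expR_gt0//.
apply: (wasserstein_contraction (measurable_flow sigma t cb)
  (measurable_converging sigma t cb) (expR_gt0 _) _ nuE muE nuG muG p0).
by move=> x y w; exact: flow_contraction.
Qed.

(** On quiet paths the two Euler schemes stay where the drift is almost linear,
and the lower bound on their distance survives the limit. *)
Lemma flow_expansion (x v : V) (eps : R) : enorm v = 1 -> 0 < eps ->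
  exists a del t0 : R, [/\ 0 < a, 0 < del, 0 < t0 &
  forall t (w : W), 0 < t -> t < t0 -> quiet a w ->
    converging b sigma t (x, w) -> converging b sigma t (x + del *: v, w) ->
    [/\ enorm (flow b sigma t (x, w) - x) <= 1,
        enorm (flow b sigma t (x + del *: v, w) - x) <= 1 &
        del * (1 + t * (dot v (v *m A x) - eps)) <=
          dot v (flow b sigma t (x + del *: v, w) - flow b sigma t (x, w))]].
Proof.
move=> v1 eps0; have [rho [del [t0 [rho0 del0 t00 H]]]] := euler_expansion C0 taylor lipA x v1 eps0.
set y := x + del *: v in H *.
pose S := \sum_i enorm (row i sigma^T).
have S0 : 0 <= S by apply: sumr_ge0 => i _; exact: enorm_ge0.
pose a := rho / (10 * (d%:R + 1) * (S + 1)).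
have den0 : 0 < 10 * (d%:R + 1) * (S + 1) by rewrite !mulr_gt0 ?ltr_wpDl.
have a0 : 0 < a by rewrite divr_gt0.
have aS : S * (d%:R * (10 * a)) <= rho.
  have -> : rho = (10 * (d%:R + 1) * (S + 1)) * a by rewrite /a mulrCA mulfV ?mulr1// gt_eqF.
  have dS : S * d%:R <= (S + 1) * (d%:R + 1) by rewrite ler_pM// lerDl.
  by have := ler_wpM2r (ltW a0) dS; lra.
exists a, del, t0; split => // t w tp tt0 qw [_ cx] [_ cy].
have near_sum e : 0 < e -> exists N : nat,
   enorm (euler_end b t x (noise sigma w) N - flow b sigma t (x, w)) <= e /\
   enorm (euler_end b t y (noise sigma w) N - flow b sigma t (y, w)) <= e.
  move=> e0; move/cvgrPdist_le : cx => /(_ _ e0) [n1 _ h1].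
  move/cvgrPdist_le : cy => /(_ _ e0) [n2 _ h2].
  exists (maxn n1 n2); split.
    by have := h1 _ (leq_maxl n1 n2); rewrite sub0r normrN ger0_norm ?enorm_ge0.
  by have := h2 _ (leq_maxr n1 n2); rewrite sub0r normrN ger0_norm ?enorm_ge0.
have E N : [/\ enorm (euler_end b t x (noise sigma w) N - x) <= 1,
    enorm (euler_end b t y (noise sigma w) N - x) <= 1 &
    del * (1 + t * (dot v (v *m A x) - eps)) <=
      dot v (euler_end b t y (noise sigma w) N - euler_end b t x (noise sigma w) N)].
  apply: H => //.
  - by rewrite divr_ge0 ?exprn_ge0 ?(ltW tp).
  - exact: (dyadic_end t N).
  - move=> k kN; apply: le_trans aS; exact: (quiet_noise sigma (ltW a0) qw kN).
split.
- apply/ler_addgt0Pr => e e0; have [N [h1 _]] := near_sum e e0; have [e1 _ _] := E N.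
  rewrite -(subrK (euler_end b t x (noise sigma w) N) (flow b sigma t (x, w))) -addrA.
  by rewrite (le_trans (ler_enormD _ _))// [leRHS]addrC lerD// enorm_distC.
- apply/ler_addgt0Pr => e e0; have [N [_ h2]] := near_sum e e0; have [_ e1 _] := E N.
  rewrite -(subrK (euler_end b t y (noise sigma w) N) (flow b sigma t (y, w))) -addrA.
  by rewrite (le_trans (ler_enormD _ _))// [leRHS]addrC lerD// enorm_distC.
apply/ler_addgt0Pr => e e0; have e20 : 0 < e / 2 by rewrite divr_gt0.
have [N [h1 h2]] := near_sum _ e20; have [_ _ e1] := E N.
move: h1 h2 e1; set X := euler_end b t x _ N; set Y := euler_end b t y _ N.
set X' := flow b sigma t (x, w); set Y' := flow b sigma t (y, w) => h1 h2 e1.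
have -> : Y' - X' = (Y - X) + ((X - X') - (Y - Y')).
  by apply/rowP => i; rewrite !mxE; ring.
rewrite dotDr; have := normr_dot v ((X - X') - (Y - Y')); rewrite v1 mul1r ler_norml.
move=> /andP[h3 _]; have := ler_enormB (X - X') (Y - Y').
move: e1 h1 h2 h3; move: (dot v _) (dot v _) (enorm _) (enorm _) (enorm _) => *; lra.
Qed.

Lemma dirac_semigroup_law (t : R) (t0 : 0 < t) d1 (T1 : measurableType d1)
    (P1 : probability T1 R) (B1 : R -> T1 -> V) (bm1 : standard_brownian_motion P1 B1) (x : V) :
  (forall D, measurable D ->
     Pt t (pdirac x) D = wiener_law bm1 t0 ((fun w => flow b sigma t (x, w)) @^-1` D)) /\ {ae (wiener_law bm1 t0), forall w, converging b sigma t (x, w)}.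
Proof.
have [lawE full] := semigroup_law t0 bm1 (pdirac x).
exact: (dirac_section (measurable_flow sigma t cb) (measurable_converging sigma t cb) lawE full).
Qed.

Lemma small_time_margins (t q e : R) : 0 < t -> 0 < e -> `|t * q| + 2 * e * t < 1 ->
  [/\ 0 <= 1 + t * (q - e), 1 + t * (q - e) <= 2 & 0 < 1 + t * (q - 2 * e)].
Proof.
move=> t0 e0 h; have et := mulr_gt0 e0 t0.
have h1 := ler_norm (t * q); have h2 := ler_norm (- (t * q)); rewrite normrN in h2.
by split; rewrite mulrBr; lra.
Qed.

(** Tested on [x] and [x + del *: v] with [del] fixed and [t] going to [0]: the
expansion holds on quiet paths, and the others have probability of order
[t ^ 2]. *)
Lemma contraction_rate_lower (e : R) : 0 < e ->
  (forall e', 0 < e' -> exists x v : V, enorm v = 1 /\ - lam - e' < dot v (v *m A x)) ->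
  exists2 t1 : R, 0 < t1 & forall t, 0 < t -> t < t1 ->
    ((1 - lam * t - e * t)%:E <= contraction_rate Pt p t)%E.
Proof.
move=> e0 adh; pose e' := e / 3; have e'0 : 0 < e' by rewrite divr_gt0.
have [x [v [v1 qv]]] := adh e' e'0; set q := dot v (v *m A x) in qv.
have [a [del [t0 [a0 del0 t00 H]]]] := flow_expansion x v1 e'0.
set y := x + del *: v in H.
have xy : enorm (x - y) = del.
  by rewrite enorm_distC /y addrC addKr enormZ v1 mulr1 gtr0_norm.
pose kap := 640 * d%:R / a ^+ 4.
have kap0 : 0 <= kap by rewrite divr_ge0 ?mulr_ge0 ?ler0n ?exprn_ge0 ?(ltW a0).
pose Lb := expR `|lam|; have Lb0 : 0 < Lb by exact: expR_gt0.
(* [t < z] keeps the expansion factors between [0] and [2]; [t < s] makes the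
   loss on non-quiet paths at most [e' * t], relative to [del]. *)
pose z := 1 / (`|q| + 2 * e' + 1).
have z1 : 0 < `|q| + 2 * e' + 1 by rewrite ltr_wpDl// addr_ge0// mulr_ge0// ltW.
pose s := e' / ((2 + Lb) * kap + 1).
have s1 : 0 < (2 + Lb) * kap + 1 by rewrite ltr_wpDl// mulr_ge0// addr_ge0// ltW.
exists (Num.min (Num.min t0 1) (Num.min z s)).
  by rewrite !lt_min t00 ltr01 !divr_gt0.
move=> t tp; rewrite !lt_min => /andP[/andP[tt0 t1] /andP[tz ts]].
have qt : `|t * q| + 2 * e' * t < 1.
  move: tz; rewrite ltr_pdivlMr// normrM gtr0_norm//.
  have : 0 <= t by exact: ltW.
  move: (`|q|) => aq; nra.
have smallt : (2 + Lb) * kap * t <= e'.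
  move: (ltW ts); rewrite ler_pdivlMr//; have := ltW tp; move: ((2 + Lb) * kap) => K; nra.
have [d1 [T1 [P1 [B1 [X1 [sol1 _]]]]]] := hPt (pdirac 0).
have bm1 := sol_brownian sol1.
have Qq0 := quiet_probability bm1 tp a0.
have [xE xG] := dirac_semigroup_law tp bm1 x.
have [yE yG] := dirac_semigroup_law tp bm1 y.
move: (wiener_law bm1 tp) Qq0 xE xG yE yG => Q Qq0 xE xG yE yG.
pose X w := flow b sigma t (x, w); pose Y w := flow b sigma t (y, w).
have mXY u : measurable_fun setT (fun w : W => flow b sigma t (u, w)).
  exact: measurable_fun_pair2 (measurable_flow sigma t cb).
pose m := del * (1 + t * (q - e')); pose L := del * Lb; pose k := kap * t ^+ 2.
have [m_lo m_hi c1] := small_time_margins tp e'0 qt.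
have m0 : 0 <= m by rewrite mulr_ge0// ltW.
have L0 : 0 <= L by rewrite mulr_ge0// ltW.
have Qq : ((1 - k)%:E <= Q (quiet a))%E.
  apply: le_trans Qq0.
  by rewrite lee_fin le_eqVlt; apply/orP; left; apply/eqP; rewrite /k /kap mulrAC.
have good : {ae Q, forall w, quiet a w -> clipped_dot v x (X w) + m <= clipped_dot v x (Y w)}.
  apply: filterS2 xG yG => w gx gy qw; have [h1 h2 h3] := H t w tp tt0 qw gx gy.
  rewrite !clipped_dot_near// -addrA lerD2l addrC -lerBrDr -dotNr -dotDr.
  by rewrite opprB addrA subrK.
have bad : {ae Q, forall w, clipped_dot v x (X w) <= clipped_dot v x (Y w) + L}.
  apply: filterS2 xG yG => w gx gy.
  rewrite addrC -lerBlDr; apply: le_trans (clipped_dot_lipschitz x (Y w) (X w) v1) _.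
  apply: le_trans (flow_contraction tp gy gx) _.
  rewrite enorm_distC xy mulrC ler_wpM2l ?(ltW del0)// ler_expR mulNr.
  apply: le_trans (ler_norm _) _; rewrite normrN normrM (gtr0_norm tp).
  by rewrite -[leRHS]mulr1 ler_wpM2l// ltW.
have sep := mean_separation (mXY x) (mXY y) xE yE (measurable_clipped_dot v x)
  (clipped_dot_bounded v x) m0 L0 (measurable_quiet a) Qq good bad.
pose c := del * (1 + t * (q - 2 * e')).
have c0 : 0 < c by rewrite mulr_gt0.
have cmL : c <= m - (m + L) * k.
  have : (m + L) * k <= del * (e' * t).
    have -> : (m + L) * k = del * (((1 + t * (q - e')) + Lb) * kap * t * t).
      by rewrite /m /L /k; ring.
    rewrite ler_wpM2l ?(ltW del0)// ler_wpM2r ?(ltW tp)//; apply: le_trans smallt.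
    by rewrite !ler_wpM2r ?(ltW tp)// lerD2r.
  have -> : c = m - del * (e' * t) by rewrite /c /m; ring.
  by rewrite lerD2l lerN2.
have low : (c%:E <= wasserstein p (Pt t (pdirac x)) (Pt t (pdirac y)))%E.
  apply: (kantorovich_lower p1 c0 (measurable_clipped_dot v x) (clipped_dot_bounded v x)).
    by move=> z1' z2'; exact: clipped_dot_lipschitz.
  by apply: le_trans sep; rewrite leeD2l// lee_fin.
have up := wasserstein_dirac x y p1; rewrite xy in up.
have rat := ratio_ge c0 del0 (wasserstein_ge0 _ _ _) low up.
apply: (@le_trans _ _ (c / del)%:E).
  rewrite lee_fin /c mulrAC mulfV ?gt_eqF// mul1r.
  have -> : 1 - lam * t - e * t = 1 + t * (- lam - e' - 2 * e') by rewrite /e'; field.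
  by rewrite lerD2l ler_wpM2l ?(ltW tp)// lerD2r ltW.
apply: le_trans rat _; apply: ereal_sup_ubound; exists (pdirac x), (pdirac y); split => //.
- exact: dirac_finite_moment.
- exact: dirac_finite_moment.
- by apply: dirac_distinct; rewrite xy.
Qed.

End contraction_rate_bounds.

(** * First-order expansion of the contraction rate *)

Lemma expR_second_order (R : realType) (x : R) : x <= 1 / 2 -> expR x <= 1 + x + 2 * x ^+ 2.
Proof.
move=> x2; have h := expR_ge1Dx (- x); have x1 : 0 < 1 - x by lra.
have : expR x <= (1 - x)^-1.
  rewrite -[expR x]invrK lef_pV2 ?posrE ?invr_gt0 ?expR_gt0//.
  by rewrite -expRN.
move=> /le_trans; apply; rewrite -[leLHS]mul1r ler_pdivrMr//.
have -> : (1 + x + 2 * x ^+ 2) * (1 - x) = 1 + x ^+ 2 * (1 - 2 * x) by ring.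
by rewrite lerDl mulr_ge0 ?sqr_ge0//; lra.
Qed.

Lemma first_order_expansion (R : realType) (lam : R) (g : R -> \bar R) :
  (forall t, 0 < t -> (g t <= (expR (- lam * t))%:E)%E) ->
  (forall e, 0 < e -> exists2 t1 : R, 0 < t1 & forall t, 0 < t -> t < t1 ->
     ((1 - lam * t - e * t)%:E <= g t)%E) ->
  exists r : R -> R, r =o_ (0^'+) (fun t : R => t) /\
    \forall t \near 0^'+, g t = (1 - lam * t + r t)%:E.
Proof.
move=> up lo; exists (fun t => fine (g t) - (1 - lam * t)).
have fin t : 0 < t -> ((1 - lam * t - 1 * t)%:E <= g t)%E -> g t = (fine (g t))%:E.
  move=> t0; have := up t t0; case: (g t) => //=.
have near0 (P : R -> Prop) (t1 : R) : 0 < t1 -> (forall t, 0 < t -> t < t1 -> P t) ->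
    \forall t \near 0^'+, P t.
  move=> t10 H; apply/nbhs_ballP; exists t1 => //= t.
  rewrite /ball/= sub0r normrN => tt1 t0; apply: H => //.
  by rewrite (le_lt_trans (ler_norm _) tt1).
split.
  apply/eqoP => e e0; have [t1 t10 h1] := lo e e0; have [t2 t20 h2] := lo 1 ltr01.
  pose K := 2 * lam ^+ 2 + 1; have K0 : 0 < K by rewrite ltr_wpDl// mulr_ge0 ?sqr_ge0.
  pose K' := 2 * (`|lam| + 1); have K'0 : 0 < K' by rewrite mulr_gt0// ltr_wpDl.
  apply: (near0 _ (Num.min (Num.min t1 t2) (Num.min (e / K) (1 / K')))).
    by rewrite !lt_min t10 t20 !divr_gt0.
  move=> t t0; rewrite !lt_min => /andP[/andP[tt1 tt2] /andP[te tK]].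
  have := h1 t t0 tt1; have := up t t0; have := fin t t0 (h2 t t0 tt2).
  move: (fine (g t)) => G ->; rewrite !lee_fin.
  move=> u l; rewrite (gtr0_norm t0) ler_norml.
  have lt2 : - lam * t <= 1 / 2.
    move: tK; rewrite ltr_pdivlMr// /K'; have := ler_norm (- lam); rewrite normrN.
    have := t0; move: (`|lam|) => al; nra.
  have := expR_second_order lt2.
  have : 2 * (- lam * t) ^+ 2 <= e * t.
    move: te; rewrite ltr_pdivlMr// /K => te.
    have -> : 2 * (- lam * t) ^+ 2 = (2 * lam ^+ 2 * t) * t by ring.
    by rewrite ler_wpM2r ?(ltW t0)//; lra.
  move: u l; move: (expR _) => E u l h3 h4; apply/andP; split; lra.
have [t2 t20 h2] := lo 1 ltr01; apply: (near0 _ t2 t20) => t t0 tt2.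
by rewrite (fin t t0 (h2 t t0 tt2)) /= addrC subrK.
Qed.

Theorem proposition3 (R : realType) (d : nat) (hd : (1 <= d)%N)
    (sigma : 'M[R]_d) (b : 'rV[R]_d -> 'rV[R]_d)
    (hb2 : class_C 2 b)
    (hbD2 : bounded_second_derivatives b)
    (hbL : one_sided_lipschitz b)
    (Pt : R -> probability 'rV[R]_d R -> probability 'rV[R]_d R)
    (hPt : is_sde_semigroup b sigma Pt)
    (p : R) (hp : 1 <= p) :
  exists r : R -> R,
    r =o_ (0^'+) (fun t : R => t) /\
    \forall t \near 0^'+,
      contraction_rate Pt p t
      = (1 - bakry_emery_curvature b * t + r t)%:E.
Proof.
have [C C0 [taylor lipJ]] := c2_taylor hb2 hbD2.
have cb : continuous b by have [] := hb2.
have [L [_ ol]] := hbL.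
have hs := rayleigh_has_sup taylor hd ol.
have upJ := rayleigh_le_sup hs.
have adh := rayleigh_adherent hs.
apply: first_order_expansion => [t t0|e e0].
  apply: (contraction_rate_upper C0 taylor lipJ cb _ hPt hp t0) => x v.
  by rewrite /bakry_emery_curvature opprK; exact: upJ.
apply: (contraction_rate_lower C0 taylor lipJ cb _ hPt hp e0) => [x v|e' e'0].
  by rewrite /bakry_emery_curvature opprK; exact: upJ.
have [x [v h]] := adh e' e'0; exists x, v.
by rewrite /bakry_emery_curvature opprK; exact: h.
Qed.
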